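(* Let $\mathcal X\subseteq\mathbb R^d$ be a set which is contained in the closure of its interior and is endowed with a matrix-valued kernel $K\in\mathcal C^{s,s}(\mathcal X\times\mathcal X,\mathbb R^{Q\times Q})$ for some $s\in\mathbb N$, with vector-valued RKHS $\mathcal F_K$. Let $I\in\mathbb N$ and partition $[I]$ into two disjoint index sets $\mathcal I_{\mathrm{SOC}}$ and $\mathcal I_\Omega$. Let $C\subseteq\mathcal F_K\times\mathbb R^B$ be the original constraint set and $C^i_{P_i,\mathrm{SOC}}$ ($i\in\mathcal I_{\mathrm{SOC}}$), $C^i_{1,\Omega}$ ($i\in\mathcal I_\Omega$) the tightened constraint sets defined in the context, and put $C_{\mathrm{app}}:=\big(\bigcap_{i\in\mathcal I_{\mathrm{SOC}}}C^i_{P_i,\mathrm{SOC}}\big)\cap\big(\bigcap_{i\in\mathcal I_\Omega}C^i_{1,\Omega}\big)$. Let $\mathcal L:\mathcal F_K\times\mathbb R^B\to\mathbb R\cup\{\infty\}$ and let $\hat{\mathcal F}_K$ be a closed subspace of $\mathcal F_K$ equipped with $\|\cdot\|_K$. Consider the problems $$(\mathscr P_{\mathrm{app}}):\ \min_{\mathbf f\in\hat{\mathcal F}_K,\ \mathbf b\in\mathbb R^B,\ (\mathbf f,\mathbf b)\in C_{\mathrm{app}}}\mathcal L(\mathbf f,\mathbf b),\qquad(\mathscr P):\ \min_{\mathbf f\in\mathcal F_K,\ \mathbf b\in\mathbb R^B,\ (\mathbf f,\mathbf b)\in C}\mathcal L(\mathbf f,\mathbf b).$$ 1. (Existence) Assume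 that (i) $\mathcal L$ is weakly lower semi-continuous and coercive over $\mathcal F_K\times\mathbb R^B$, and (ii) there exists an admissible pair $(\mathbf f,\mathbf b)\in C_{\mathrm{app}}\cap\operatorname{dom}(\mathcal L)\cap(\hat{\mathcal F}_K\times\mathbb R^B)$. Then there exists a minimizer $(\bar{\mathbf f}_{\mathrm{app}},\bar{\mathbf b}_{\mathrm{app}})$ of $(\mathscr P_{\mathrm{app}})$ and a solution $(\bar{\mathbf f},\bar{\mathbf b})$ of $(\mathscr P)$. 2. (Certificate of optimality) Let $v_{\mathrm{app}}$, $\bar v$ and $v_{\mathrm{relax}}$ be the optimal values of $(\mathscr P_{\mathrm{app}})$, of $(\mathscr P)$ and of any given relaxation of $(\mathscr P)$, respectively. Then $v_{\mathrm{relax}}\le\bar v\le v_{\mathrm{app}}$.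
   Context: $[n]=\{1,\dots,n\}$; $\preccurlyeq$ is the Loewner order; $\mathbf I_P$ the identity; $\mathscr S^{P-1}$ the Euclidean unit sphere of $\mathbb R^P$; $\|\cdot\|_{\mathcal X}$ a fixed norm on $\mathbb R^d$; $\mathbb B_{\mathcal X}(\mathbf c,r)=\{\mathbf x\in\mathcal X:\|\mathbf x-\mathbf c\|_{\mathcal X}\le r\}$. A problem is a relaxation of another if both have the same objective function and the search space of the former contains that of the latter. A function $g:\mathcal Y\to\mathbb R\cup\{\infty\}$ on a Hilbert space is weakly l.s.c. if its sublevel sets $\{g\le\gamma\}$, $\gamma\in\mathbb R$, are weakly closed, and coercive if they are all bounded; $\operatorname{dom}(g)=\{g<\infty\}$. Kernels and operators. Matrix-valued kernel: $K(\mathbf x,\mathbf x')=K(\mathbf x',\mathbf x)^\top$ and $\sum_{i,j}\mathbf v_i^\top K(\mathbf x_i,\mathbf x_j)\mathbf v_j\ge0$ for all finite families. $\mathcal F_K$ (inner product $\langle\cdot,\cdot\rangle_K$, norm $\|\cdot\|_K$) is the Hilbert space of functions $\mathcal X\to\mathbb R^Q$ containing all $K(\cdot,\mathbf x)\mathbf c$ with $\langle\mathbf f,K(\cdot,\mathbf x)\mathbf c\rangle_K=\langle\mathbf f(\mathbf x),\mathbf c\rangle$. $\mathcal C^{s,s}$: $\partial^{\mathbf r,\mathbf r}$ (order $\mathbf r$ in each of the two arguments) exists and is continuous for all $|\mathbf r|\le s$ (derivatives at non-interior points are continuous extensions from the interior). $O_{1,s}$: operators $f\mapsto\sum_{j\in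 J}c_j\partial^{\mathbf r_j}f$, $J$ finite, $|\mathbf r_j|\le s$, $c_j\in\mathbb R$. $O_{Q,s}$: operators $D(\mathbf f)(\mathbf x)=\sum_{q\in[Q]}\beta_qD_q(f_q)(\mathbf x)$, $\beta_q\in\mathbb R$, $D_q\in O_{1,s}$. For such $D$, $DK(\mathbf x',\mathbf x):=\sum_q\beta_qD_q[\mathbf x''\mapsto K(\mathbf x',\mathbf x'')](\mathbf x)\mathbf e_q\in\mathbb R^Q$; every $\mathbf f\in\mathcal F_K$ is $\mathcal C^s$, $DK(\cdot,\mathbf x)\in\mathcal F_K$ and $D(\mathbf f)(\mathbf x)=\langle\mathbf f,DK(\cdot,\mathbf x)\rangle_K$. Original constraints. For $i\in[I]$ we are given a compact set $\mathscr K_i\subseteq\mathcal X$, an integer $P_i\ge1$ with $P_i=1$ if $i\in\mathcal I_\Omega$, $\mathbf D_i=[D^i_{p_1,p_2}]_{p_1,p_2\in[P_i]}$ with $D^i_{p_1,p_2}\in O_{Q,s}$ and $\mathbf D_i(\mathbf f)(\mathbf x)$ always symmetric (for $P_i=1$ write $D_i$), $\mathbf f_{0,i}\in\mathcal F_K$, $\mathbf b_{0,i}\in\mathbb R^{P_i}$, $\boldsymbol\Gamma_i\in\mathbb R^{P_i\times B}$; $$C=\{(\mathbf f,\mathbf b)\in\mathcal F_K\times\mathbb R^B:\ \mathbf 0\preccurlyeq\mathbf D_i(\mathbf f-\mathbf f_{0,i})(\mathbf x)+\operatorname{diag}(\boldsymbol\Gamma_i\mathbf b-\mathbf b_{0,i})\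 \forall\mathbf x\in\mathscr K_i,\ \forall i\in[I]\}.$$ Tightened constraints, $i\in\mathcal I_{\mathrm{SOC}}$. Fix finitely many $\tilde{\mathbf x}_{i,m}\in\mathcal X$, $\delta_{i,m}>0$ ($m\in[M_i]$) with $\mathscr K_i\subseteq\bigcup_m\mathbb B_{\mathcal X}(\tilde{\mathbf x}_{i,m},\delta_{i,m})$, let $$\eta_{i,m,P_i}=\sup_{\mathbf x\in\mathbb B_{\mathcal X}(\tilde{\mathbf x}_{i,m},\delta_{i,m}),\ \mathbf u\in\mathscr S^{P_i-1}}\Big\|\sum_{p_1,p_2\in[P_i]}u_{p_1}u_{p_2}[D^i_{p_1,p_2}K(\cdot,\tilde{\mathbf x}_{i,m})-D^i_{p_1,p_2}K(\cdot,\mathbf x)]\Big\|_K$$ and let $C^i_{P_i,\mathrm{SOC}}$ be the set of $(\mathbf f,\mathbf b)\in\mathcal F_K\times\mathbb R^B$ with $\eta_{i,m,P_i}\|\mathbf f-\mathbf f_{0,i}\|_K\mathbf I_{P_i}\preccurlyeq\mathbf D_i(\mathbf f-\mathbf f_{0,i})(\tilde{\mathbf x}_{i,m})+\operatorname{diag}(\boldsymbol\Gamma_i\mathbf b-\mathbf b_{0,i})$ for all $m\in[M_i]$. Tightened constraints, $i\in\mathcal I_\Omega$. Fix finitely many non-empty sets $$\Omega_{i,m}=\Big(\bigcap_{j\in[J_{B,i,m}]}\{\mathbf g\in\mathcal F_K:\|\mathbf g-\mathbf c_{i,m,j}\|_K<r_{i,m,j}\}\Big)\cap\Big(\bigcap_{j\in[J_{H,i,m}]}\{\mathbf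 g\in\mathcal F_K:\langle\mathbf v_{i,m,j},\mathbf g\rangle_K<\rho_{i,m,j}\}\Big),\quad m\in[M_i],$$ with $\mathbf c_{i,m,j}\in\mathcal F_K$, $r_{i,m,j}>0$, $\mathbf 0\ne\mathbf v_{i,m,j}\in\mathcal F_K$, $\rho_{i,m,j}\in\mathbb R$, such that $\{D_iK(\cdot,\mathbf x):\mathbf x\in\mathscr K_i\}\subseteq\bigcup_{m}\overline{\Omega_{i,m}}$. $C^i_{1,\Omega}$ is the set of $(\mathbf f,\mathbf b)\in\mathcal F_K\times\mathbb R^B$ such that for every $m\in[M_i]$ there exist $\mathbf g_j\in\operatorname{span}(\mathbf f-\mathbf f_{0,i},\{\mathbf c_{i,m,l}\}_l,\{\mathbf v_{i,m,l}\}_l)$ ($j\in[J_{B,i,m}]$) and $\xi_j\ge0$ ($j\in[J_{H,i,m}]$) with $$-b_{0,i}+\boldsymbol\Gamma_i\mathbf b+\sum_j\langle\mathbf g_j,\mathbf c_{i,m,j}\rangle_K-\sum_j\xi_j\rho_{i,m,j}-\sum_jr_{i,m,j}\|\mathbf g_j\|_K\ge0,\qquad-(\mathbf f-\mathbf f_{0,i})+\sum_j\mathbf g_j-\sum_j\xi_j\mathbf v_{i,m,j}=\mathbf 0$$ (equivalently, $\Omega_{i,m}\subseteq\{\mathbf g:\langle\mathbf f-\mathbf f_{0,i},\mathbf g\rangle_K\ge b_{0,i}-\boldsymbol\Gamma_i\mathbf b\}$ for all $m$). *)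

(* Defs.v *)
From HB Require Import structures.
From mathcomp Require Import all_boot all_order all_algebra.
From mathcomp Require Import all_classical all_reals all_analysis.

Set Implicit Arguments.
Unset Strict Implicit.
Unset Printing Implicit Defensive.
Import Order.TTheory GRing.Theory Num.Theory.
Import numFieldNormedType.Exports.

Local Open Scope classical_set_scope.
Local Open Scope ring_scope.

Section Norms_and_Loewner.
Context {R : realType}.

Definition is_norm (V : lmodType R) (N : V -> R) : Prop :=
  [/\ forall x y, N (x + y) <= N x + N y,
      forall a x, N (a *: x) = `|a| * N x &
      forall x, N x = 0 -> x = 0].

Definition cvdot n (u v : 'cV[R]_n) : R := (u^T *m v) 0 0.

Definition psdmx n (A : 'M[R]_n) : Prop :=
  A^T = A /\ forall u : 'cV[R]_n, 0 <= cvdot u (A *m u).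

Definition loewner n (A B : 'M[R]_n) : Prop := psdmx (B - A).

End Norms_and_Loewner.

Section Partial_derivatives.
Context {R : realType} {d : nat}.
Implicit Types (f : 'rV[R]_d -> R) (U X : set 'rV[R]_d).

Definition multiindex := {ffun 'I_d -> nat}.

Definition mdeg (r : multiindex) : nat := (\sum_i r i)%N.

(* [:: 0; ..; 0; 1; ..; 1; ..] with r i copies of i *)
Definition mword (r : multiindex) : seq 'I_d :=
  flatten [seq nseq (r i) i | i <- enum 'I_d].

(* The head of w is the outermost derivative. *)
Fixpoint wderiv (w : seq 'I_d) f : 'rV[R]_d -> R :=
  if w is i :: w' then 'D_('e_i) (wderiv w' f) else f.

Fixpoint wderivable (U : set 'rV[R]_d) (w : seq 'I_d) f : Prop :=
  if w is i :: w' then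
    wderivable U w' f /\
    forall x, U x -> derivable (wderiv w' f) x 'e_i
  else True.

Definition pderiv (r : multiindex) f : 'rV[R]_d -> R := wderiv (mword r) f.

Definition pderivable U (r : multiindex) f : Prop := wderivable U (mword r) f.

(* h on U, and its limit from inside U at the other points *)
Definition extend_lim (T : topologicalType) (U : set T) (h : T -> R) (x : T) : R :=
  if x \in U then h x else lim (h @ within U (nbhs x)).

(* The r-th partial derivative on X of a function given on X only: at an
   interior point of X it does not depend on the values of f outside X. *)
Definition pderivX X (r : multiindex) f : 'rV[R]_d -> R :=
  if mdeg r == 0%N then f else extend_lim X° (pderiv r f).

Definition pderiv2 (r : multiindex) (k : 'rV[R]_d -> 'rV[R]_d -> R)
    (z : 'rV[R]_d * 'rV[R]_d) : R :=
  pderiv r (fun x => pderiv r (k x) z.2) z.1.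

Definition pderivable2 U (r : multiindex) (k : 'rV[R]_d -> 'rV[R]_d -> R) : Prop :=
  (forall x, U x -> pderivable U r (k x)) /\
  (forall y, U y -> pderivable U r (fun x => pderiv r (k x) y)).

Definition pderiv2X X (r : multiindex) (k : 'rV[R]_d -> 'rV[R]_d -> R) :
    'rV[R]_d * 'rV[R]_d -> R :=
  if mdeg r == 0%N then (fun z => k z.1 z.2)
  else extend_lim (X° `*` X°) (pderiv2 r k).

(* C^{s,s}(X x X); continuity of pderiv2X on X x X is the existence of the
   continuous extension from the interior. *)
Definition Css X (s : nat) Q (K : 'rV[R]_d -> 'rV[R]_d -> 'M[R]_Q) : Prop :=
  forall (r : multiindex) (p q : 'I_Q), (mdeg r <= s)%N ->
    pderivable2 X° r (fun x y => K x y p q) /\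
    {within X `*` X, continuous (pderiv2X X r (fun x y => K x y p q))}.

(* [:: (c_1, r_1); ..; (c_J, r_J)] stands for f |-> sum_j c_j d^{r_j} f. *)
Definition diffop1 := seq (R * multiindex).

Definition diff_app1 X (D : diffop1) f (x : 'rV[R]_d) : R :=
  \sum_(cr <- D) cr.1 * pderivX X cr.2 f x.

Definition order1 (s : nat) (D : diffop1) : bool :=
  all (fun cr => (mdeg cr.2 <= s)%N) D.

(* q |-> (beta_q, D_q) stands for f |-> sum_q beta_q D_q (f_q). *)
Definition diffop Q := 'I_Q -> R * diffop1.

Definition diff_app X Q (D : diffop Q) (f : 'rV[R]_d -> 'cV[R]_Q) (x : 'rV[R]_d) : R :=
  \sum_q (D q).1 * diff_app1 X (D q).2 (fun y => f y q 0) x.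

Definition in_O Q (s : nat) (D : diffop Q) : Prop := forall q, order1 s (D q).2.

(* D K(x', x); the q-th summand is
   beta_q * D_q [x'' |-> K(x', x'')](x) * e_q, with D_q acting entrywise. *)
Definition DK X Q (K : 'rV[R]_d -> 'rV[R]_d -> 'M[R]_Q) (D : diffop Q)
    (x' x : 'rV[R]_d) : 'cV[R]_Q :=
  \sum_q (D q).1 *:
    (\matrix_(p, q') diff_app1 X (D q).2 (fun x'' => K x' x'' p q') x *m
     (delta_mx q 0 : 'cV[R]_Q)).

End Partial_derivatives.

Arguments multiindex : clear implicits.
Arguments diffop1 : clear implicits.
Arguments diffop : clear implicits.

Section Kernels_and_RKHS.
Context {R : realType} {d Q : nat}.

Definition matrix_kernel (X : set 'rV[R]_d)
    (K : 'rV[R]_d -> 'rV[R]_d -> 'M[R]_Q) : Prop :=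
  (forall x y, X x -> X y -> K x y = (K y x)^T) /\
  (forall n (x : 'I_n -> 'rV[R]_d) (v : 'I_n -> 'cV[R]_Q),
    (forall i, X (x i)) ->
    0 <= \sum_i \sum_j cvdot (v i) (K (x i) (x j) *m v j)).

(* F is the RKHS of K: a complete space whose norm comes from ip, and whose
   elements f are identified with the functions ev f restricted to X. *)
Record is_rkhs (X : set 'rV[R]_d) (K : 'rV[R]_d -> 'rV[R]_d -> 'M[R]_Q)
    (F : completeNormedModType R) (ip : {dot F for idfun})
    (ev : F -> 'rV[R]_d -> 'cV[R]_Q) : Prop := IsRKHS {
  rkhs_normE : forall f, ip f f = `|f| ^+ 2;
  rkhs_evP : forall a f g x, X x -> ev (a *: f + g) x = a *: ev f x + ev g x;
  rkhs_ev_inj : forall f g, (forall x, X x -> ev f x = ev g x) -> f = g;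
  rkhs_reproducing : forall x c, X x ->
    exists2 k : F, (forall y, X y -> ev k y = K y x *m c) &
                   forall f, ip f k = cvdot (ev f x) c }.

(* The element of F which, as a function on X, is g (0 if there is none; for
   g = D K(., x) with K of class C^{s,s} there always is one). *)
Definition as_elt (X : set 'rV[R]_d) (F : completeNormedModType R)
    (ev : F -> 'rV[R]_d -> 'cV[R]_Q) (g : 'rV[R]_d -> 'cV[R]_Q) : F :=
  xget 0 [set f | forall x, X x -> ev f x = g x].

Definition DKelt X K (F : completeNormedModType R)
    (ev : F -> 'rV[R]_d -> 'cV[R]_Q) (D : diffop R d Q) (x : 'rV[R]_d) : F :=
  as_elt X ev (fun x' => DK X K D x' x).

End Kernels_and_RKHS.

Section Constraints.
Context {R : realType} {d Q B : nat}.
Variables (X : set 'rV[R]_d) (normX : 'rV[R]_d -> R).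
Variables (K : 'rV[R]_d -> 'rV[R]_d -> 'M[R]_Q).
Variables (F : completeNormedModType R) (ip : {dot F for idfun}).
Variable (ev : F -> 'rV[R]_d -> 'cV[R]_Q).

Record constraint := Constraint {
  cP : nat;
  cset : set 'rV[R]_d;
  cD : 'I_cP -> 'I_cP -> diffop R d Q;
  cf0 : F;
  cb0 : 'cV[R]_cP;
  cGamma : 'M[R]_(cP, B) }.

Definition diff_mx (c : constraint) (f : F) (x : 'rV[R]_d) : 'M[R]_(cP c) :=
  \matrix_(p1, p2) diff_app X (cD p1 p2) (ev f) x.

Definition cons_mx (c : constraint) (z : F * 'cV[R]_B) (x : 'rV[R]_d) :
    'M[R]_(cP c) :=
  diff_mx c (z.1 - cf0 c) x + diag_mx (cGamma c *m z.2 - cb0 c)^T.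

Definition original_set I (c : 'I_I -> constraint) : set (F * 'cV[R]_B) :=
  [set z | forall i x, cset (c i) x -> loewner 0 (cons_mx (c i) z x)].

Definition ballX (x0 : 'rV[R]_d) (r : R) : set 'rV[R]_d :=
  [set x | X x /\ normX (x - x0) <= r].

Definition sphere n : set 'cV[R]_n := [set u | cvdot u u = 1].

Record ball_cover := BallCover {
  bM : nat;
  bcenter : 'I_bM -> 'rV[R]_d;
  bradius : 'I_bM -> R }.
Arguments bcenter : clear implicits.
Arguments bradius : clear implicits.

Definition is_ball_cover (A : set 'rV[R]_d) (bc : ball_cover) : Prop :=
  [/\ forall m, X (bcenter bc m),
      forall m, 0 < bradius bc m &
      A `<=` \bigcup_m ballX (bcenter bc m) (bradius bc m)].

Definition eta (c : constraint) (x0 : 'rV[R]_d) (delta : R) : \bar R :=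
  ereal_sup [set t | exists x (u : 'cV[R]_(cP c)),
    [/\ ballX x0 delta x, sphere u &
        t = `|\sum_p1 \sum_p2 (u p1 0 * u p2 0) *:
               (DKelt X K ev (cD p1 p2) x0 - DKelt X K ev (cD p1 p2) x)|%:E]].

(* eta is a supremum in the extended reals, since X need not be closed.  If
   eta = +oo, the constraint eta * ||f - f0|| * I <= A holds only when f = f0
   (where +oo * 0 = 0) and 0 <= A. *)
Definition soc_set (c : constraint) (bc : ball_cover) : set (F * 'cV[R]_B) :=
  [set z | forall m : 'I_(bM bc),
    match (eta c (bcenter bc m) (bradius bc m) * `|z.1 - cf0 c|%:E)%E with
    | t%:E => loewner t%:M (cons_mx c z (bcenter bc m))
    | _ => False
    end].

Record cell := Cell {
  oJB : nat;
  oJH : nat;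
  oc : 'I_oJB -> F;
  orad : 'I_oJB -> R;
  ov : 'I_oJH -> F;
  orho : 'I_oJH -> R }.
Arguments oc : clear implicits.
Arguments orad : clear implicits.
Arguments ov : clear implicits.
Arguments orho : clear implicits.

Definition cell_set (w : cell) : set F :=
  [set g | (forall j : 'I_(oJB w), `|g - oc w j| < orad w j) /\
           (forall j : 'I_(oJH w), ip (ov w j) g < orho w j)].

Record cell_cover := CellCover {
  oM : nat;
  ocell : 'I_oM -> cell }.
Arguments ocell : clear implicits.

Definition is_cell_cover (A : set F) (wc : cell_cover) : Prop :=
  [/\ forall m, cell_set (ocell wc m) !=set0,
      forall m (j : 'I_(oJB (ocell wc m))), 0 < orad _ j,
      forall m (j : 'I_(oJH (ocell wc m))), ov _ j != 0 &
      A `<=` \bigcup_m closure (cell_set (ocell wc m))].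

Definition cell_span (h : F) (w : cell) : set F :=
  [set g | exists a (al : 'I_(oJB w) -> R) (be : 'I_(oJH w) -> R),
    g = a *: h + \sum_l al l *: oc w l + \sum_l be l *: ov w l].

(* Used with cP c = 1 only: p is then the unique index. *)
Definition omega_set (c : constraint) (wc : cell_cover) : set (F * 'cV[R]_B) :=
  [set z | forall (p : 'I_(cP c)) (m : 'I_(oM wc)),
    let w := ocell wc m in
    exists (g : 'I_(oJB w) -> F) (xi : 'I_(oJH w) -> R),
      [/\ forall j, cell_span (z.1 - cf0 c) w (g j),
          forall j, 0 <= xi j,
          0 <= - cb0 c p 0 + (cGamma c *m z.2) p 0
               + \sum_j ip (g j) (oc w j)
               - \sum_j xi j * orho w j
               - \sum_j orad w j * `|g j| &
          - (z.1 - cf0 c) + \sum_j g j - \sum_j xi j *: ov w j = 0]].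

Definition tightened_set I (c : 'I_I -> constraint) (ISOC IOmega : {set 'I_I})
    (bc : 'I_I -> ball_cover) (wc : 'I_I -> cell_cover) : set (F * 'cV[R]_B) :=
  (\bigcap_(i in [set` ISOC]) soc_set (c i) (bc i)) `&`
  (\bigcap_(i in [set` IOmega]) omega_set (c i) (wc i)).

End Constraints.

Arguments constraint {R} d Q B F.
Arguments ball_cover R d : clear implicits.
Arguments cell {R} F.
Arguments cell_cover {R} F.

Section Optimization.
Context {R : realType}.

Record problem (Y : Type) := Problem {
  objective : Y -> \bar R;
  search_space : set Y }.

Definition minimizer Y (p : problem Y) (y : Y) : Prop :=
  search_space p y /\
  forall y', search_space p y' -> (objective p y <= objective p y')%E.

Definition optimal_value Y (p : problem Y) : \bar R :=
  ereal_inf (objective p @` search_space p).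

Definition relaxation Y (p' p : problem Y) : Prop :=
  objective p' = objective p /\ search_space p `<=` search_space p'.

(* Y with the coarsest topology for which all continuous linear forms on the
   normed space Y are continuous *)
Definition weak_topology (Y : normedModType R) : topologicalType :=
  initial_topology
    (fun y : Y => (fun phi => sval phi y) :
      {ptws {phi : {linear Y -> R^o} | continuous phi} -> R^o}).

Definition weakly_closed (Y : normedModType R) (A : set Y) : Prop :=
  closed (A : set (weak_topology Y)).

Definition weakly_lsc (Y : normedModType R) (L : Y -> \bar R) : Prop :=
  forall gamma : R, weakly_closed [set y | (L y <= gamma%:E)%E].

Definition coercive (Y : normedModType R) (L : Y -> \bar R) : Prop :=
  forall gamma : R, bounded_set [set y | (L y <= gamma%:E)%E].

Definition edom (Y : Type) (L : Y -> \bar R) : set Y := [set y | (L y < +oo)%E].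

End Optimization.

(* Main.v *)
(* The inclusion C_app <= C and the existence of minimizers both rest on the
   reproducing property D(f)(x) = <f, DK(., x)>, which turns each original constraint
   into an affine one in (f, b).

   Reproducing property. An iterated difference quotient of x |-> K(., x) e_q has
   as squared norm the corresponding double difference of K_qq, which by the mean
   value theorem is a value of d^{r,r} K_qq nearby, hence is locally bounded. So
   h |-> d^r h_q(x) is bounded on the dense subspace of the h having this
   derivative; Riesz gives its representer, and density extends existence of the
   derivative to the whole space.  At points of X that are not interior, the
   representers converge because their Gram matrix does.

   Existence. Bounded ultrafilters converge weakly, and the constraints pass to
   weak limits: the SOC ones by lower semicontinuity of the norm; for the cell
   ones, a point of the open cell is a Slater point bounding the multipliers,
   which therefore converge weakly as well. *)
Require Import Defs.
From HB Require Import structures.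
From mathcomp Require Import all_boot all_order all_algebra.
From mathcomp Require Import all_classical all_reals all_analysis.
From mathcomp Require Import ring lra.
Set Implicit Arguments.
Unset Strict Implicit.
Unset Printing Implicit Defensive.
Import Order.TTheory GRing.Theory Num.Theory.
Import numFieldNormedType.Exports.
Local Open Scope classical_set_scope.
Local Open Scope ring_scope.

(** * Hilbert spaces *)

(** The difference quotients of derivative representers are only shown to converge weakly. This
    takes a norm bound near the point and a dense set of test elements, and both come from
    derivatives with the same multiindex in the two arguments of the kernel, which is all that class
    C^{s,s} controls.

    Weak compactness is drawn from ultrafilters: a bounded real function converges along an
    ultrafilter, so the limits of inner products against fixed elements form a bounded linear form,
    and Riesz turns it into a limit point. Constraints are therefore passed to the limit along
    filters in the sense of [weakly_to], and [weak_topology] enters only for the lower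
    semicontinuity of the objective.

    The cell constraints are existential, and the span prescribed for their multipliers moves with
    [f], so it cannot simply be followed to a weak limit. The span condition is dropped in
    [certifies], the limit is taken without it, and an orthogonal projection puts the multipliers
    back into the span. *)

Section Hilbert.
Context {R : realType} {F : completeNormedModType R} (ip : F -> F -> R).
Hypothesis ipC : forall f g, ip f g = ip g f.
Hypothesis ip_linear : forall a f g h, ip (a *: f + g) h = a * ip f h + ip g h.
Hypothesis ip_norm : forall f, ip f f = `|f| ^+ 2.

Lemma ipDl f g h : ip (f + g) h = ip f h + ip g h.
Proof. by have := ip_linear 1 f g h; rewrite scale1r mul1r. Qed.

Lemma ip0l f : ip 0 f = 0.
Proof. by have := ipDl 0 0 f; rewrite addr0; move/eqP; rewrite -subr_eq0; lra. Qed.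

Lemma ipZl a f h : ip (a *: f) h = a * ip f h.
Proof. by have := ip_linear a f 0 h; rewrite !addr0 ip0l addr0. Qed.

Lemma ipNl f h : ip (- f) h = - ip f h.
Proof. by rewrite -scaleN1r ipZl mulN1r. Qed.

Lemma ipBl f g h : ip (f - g) h = ip f h - ip g h.
Proof. by rewrite ipDl ipNl. Qed.

Lemma ipDr f g h : ip h (f + g) = ip h f + ip h g.
Proof. by rewrite !(ipC h) ipDl. Qed.

Lemma ip0r f : ip f 0 = 0.
Proof. by rewrite ipC ip0l. Qed.

Lemma ipZr a f h : ip h (a *: f) = a * ip h f.
Proof. by rewrite !(ipC h) ipZl. Qed.

Lemma ipNr f h : ip h (- f) = - ip h f.
Proof. by rewrite !(ipC h) ipNl. Qed.

Lemma ipBr f g h : ip h (f - g) = ip h f - ip h g.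
Proof. by rewrite !(ipC h) ipBl. Qed.

Lemma ip_suml I (r : seq I) (P : pred I) (f : I -> F) h :
  ip (\sum_(i <- r | P i) f i) h = \sum_(i <- r | P i) ip (f i) h.
Proof. by elim/big_rec2: _ => [|i a b _ <-]; rewrite ?ip0l ?ipDl. Qed.

Lemma ip_sumr I (r : seq I) (P : pred I) (f : I -> F) h :
  ip h (\sum_(i <- r | P i) f i) = \sum_(i <- r | P i) ip h (f i).
Proof. by rewrite ipC ip_suml; apply: eq_bigr => i _; rewrite ipC. Qed.

Lemma ip_ext f g : (forall h, ip f h = ip g h) -> f = g.
Proof.
move=> fg; apply/eqP; rewrite -subr_eq0 -normr_eq0 -sqrf_eq0 -ip_norm.
by rewrite ipBl fg subrr.
Qed.

Lemma normD_sqr f g : `|f + g| ^+ 2 = `|f| ^+ 2 + 2 * ip f g + `|g| ^+ 2.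
Proof. by rewrite -!ip_norm ipDl !ipDr (ipC g f); lra. Qed.

Lemma cauchy_schwarz f g : ip f g <= `|f| * `|g|.
Proof.
have [->|f0] := eqVneq f 0; first by rewrite ip0l normr0 mul0r.
have [->|g0] := eqVneq g 0; first by rewrite ip0r normr0 mulr0.
have nf : 0 < `|f| by rewrite normr_gt0.
have ng : 0 < `|g| by rewrite normr_gt0.
have := sqr_ge0 `| `|g| *: f + (- `|f|) *: g|.
rewrite normD_sqr !normrZ normrN !normr_id ipZl ipZr => h.
have : 0 <= (`|f| * `|g|) * (`|f| * `|g| - ip f g) by nra.
by rewrite pmulr_rge0 ?mulr_gt0// subr_ge0.
Qed.

Lemma normr_ip f g : `|ip f g| <= `|f| * `|g|.
Proof.
rewrite ler_norml cauchy_schwarz andbT lerNl -ipNl.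
by rewrite (le_trans (cauchy_schwarz _ _))// normrN.
Qed.

Lemma cvg_ipl T (G : set_system T) {FG : Filter G} (h : T -> F) y a :
  h t @[t --> G] --> y -> ip (h t) a @[t --> G] --> ip y a.
Proof.
move=> /cvgrPdist_le hy; apply/cvgrPdist_le => e e0.
have a1 : 0 < `|a| + 1 by rewrite ltr_wpDl.
have := hy (e / (`|a| + 1)); rewrite divr_gt0// => /(_ isT).
apply: filterS => t ht; rewrite -ipBl (le_trans (normr_ip _ _))//.
rewrite ler_pdivlMr// in ht; apply: le_trans ht.
by rewrite ler_wpM2l// lerDl.
Qed.

Definition lin_subspace (S : set F) :=
  S 0 /\ forall a f g, S f -> S g -> S (a *: f + g).

Lemma subspaceZ S a f : lin_subspace S -> S f -> S (a *: f).
Proof. by move=> [S0 SL] Sf; rewrite -[_ *: _]addr0; exact: SL. Qed.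

Lemma subspaceD S f g : lin_subspace S -> S f -> S g -> S (f + g).
Proof. by move=> [_ SL] Sf Sg; rewrite -[f]scale1r; exact: SL. Qed.

Lemma subspaceB S f g : lin_subspace S -> S f -> S g -> S (f - g).
Proof. by move=> [_ SL] Sf Sg; rewrite addrC -scaleN1r; exact: SL. Qed.

(* The representer is the limit of a minimizing filter of |x|^2 - 2 l(x) on S. *)
Lemma riesz (S : set F) (l : F -> R) (C : R) : lin_subspace S ->
  (forall a f g, S f -> S g -> l (a *: f + g) = a * l f + l g) ->
  (forall f, S f -> `|l f| <= C * `|f|) ->
  exists2 y, closure S y & forall f, S f -> l f = ip y f.
Proof.
move=> sS lin lC; have [S0 SL] := sS.
pose q x : R := `|x| ^+ 2 - 2 * l x.
have qlb x : S x -> - C ^+ 2 <= q x.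
  move=> Sx; have := lC _ Sx; rewrite ler_norml => /andP[_ h].
  have := sqr_ge0 (`|x| - C); rewrite /q; nra.
pose m := inf [set q x | x in S].
have hm : has_inf [set q x | x in S].
  by split; [exists (q 0), 0|exists (- C ^+ 2) => _ [x Sx <-]; exact: qlb].
have mq x : S x -> m <= q x by move=> Sx; apply: ge_inf; [case: hm|exists x].
pose G := filter_from [set e : R | 0 < e] (fun e => [set x | S x /\ q x < m + e]).
have GF : ProperFilter G.
  apply: filter_from_proper; first apply: filter_from_filter.
  - by exists 1 => /=.
  - move=> e f /= e0 f0; exists (Num.min e f) => /=; first by rewrite lt_min e0.
    move=> x /= [Sx qx]; split; split=> //; apply: (lt_le_trans qx);
      by rewrite lerD2l ge_min lexx ?orbT.
  - by move=> e e0; have [_ [x Sx <-] qx] := inf_adherent e0 hm; exists x.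
have GS : G S by exists 1 => //= x [].
(* Parallelogram law: the midpoint is in [S], so [q] is at least [m] there, while [q x + q y] minus
   twice that value is half of the squared distance. *)
have para x y e : S x -> S y -> q x < m + e -> q y < m + e ->
    `|x - y| ^+ 2 <= 4 * e.
  move=> Sx Sy qx qy.
  have Sz : S (2^-1 *: (x + y)) by apply: subspaceZ => //; exact: subspaceD.
  have lz : l (2^-1 *: (x + y)) = 2^-1 * (l x + l y).
    have l0 : l 0 = 0 by have := lin (-1) 0 0 S0 S0; rewrite scaler0 addr0; lra.
    have lD : l (x + y) = l x + l y.
      by have := lin 1 x y Sx Sy; rewrite scale1r mul1r.
    have := lin 2^-1 (x + y) 0 (subspaceD sS Sx Sy) S0.
    by rewrite addr0 l0 addr0 lD.
  have := mq _ Sz; move: qx qy; rewrite /q lz normrZ exprMn normD_sqr.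
  rewrite ger0_norm// normD_sqr normrN ipNr; lra.
have Gc : cauchy G.
  apply/cauchy_exP => e e0.
  pose d := e ^+ 2 / 8.
  have d0 : 0 < d by rewrite divr_gt0// exprn_gt0.
  have [_ [x Sx <-] qx] := inf_adherent d0 hm.
  exists x; exists d => // y [Sy qy]; rewrite -ball_normE /=.
  have := para _ _ _ Sx Sy qx qy; rewrite /d => h.
  have e2 : 0 < e ^+ 2 by rewrite exprn_gt0.
  have: `|x - y| ^+ 2 < e ^+ 2 by lra.
  by rewrite ltr_pXn2r// ?nnegrE// ltW.
have [y Gy] : exists y : F, G --> y by exists (lim G); exact: cauchy_cvg.
exists y.
  rewrite closureEcvg; exists G => //; split=> // A SA.
  exact: filterS GS.
move=> f Sf.
have Gip : ip x f @[x --> G] --> ip y f by exact: cvg_ipl.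
pose d := ip y f - l f.
(* First variation. As [y] need not lie in [S], the comparison with [t *: f + x] is made at
   near-minimizers [x] and then passed to the limit. *)
have key t : 0 <= 2 * t * d + t ^+ 2 * `|f| ^+ 2.
  apply/ler_addgt0Pr => e e0.
  have : (2 * t * (ip x f - l f) + t ^+ 2 * `|f| ^+ 2 + e) @[x --> G] -->
      (2 * t * d + t ^+ 2 * `|f| ^+ 2 + e).
    by apply: cvgD; [apply: cvgD|]; [apply: cvgMr; apply: cvgB| |];
      try exact: cvg_cst.
  move/cvgr_to_ge; apply; exists e => // x [Sx qx].
  have : m <= q (t *: f + x) by apply: mq; exact: SL.
  rewrite /q normD_sqr lin// ipZl (ipC f x) normrZ exprMn real_normK ?num_real//.
  move: qx; rewrite /q; lra.
suff d0 : d = 0 by move: d0; rewrite /d; lra.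
have n0 : 0 <= `|f| ^+ 2 by [].
set n := `|f| ^+ 2 in key n0.
(* Dividing by [n + 1] rather than [n] also covers [f = 0]; the quadratic is still negative there
   unless [d = 0]. *)
have := key (- d / (n + 1)).
have -> : 2 * (- d / (n + 1)) * d + (- d / (n + 1)) ^+ 2 * n =
   - (d / (n + 1)) ^+ 2 * (n + 2) by field; apply: lt0r_neq0; lra.
have /[swap] : 0 <= (d / (n + 1)) ^+ 2 by exact: sqr_ge0.
set u := (d / (n + 1)) ^+ 2 => u0 h.
have : u = 0 by nra.
move/eqP; rewrite sqrf_eq0 mulf_eq0 invr_eq0 => /orP[/eqP//|/eqP]; lra.
Qed.

(** The Riesz representer of [ip f] on [S] lies in [closure S] and differs from [f] by an element
    orthogonal to [S]. *)
Lemma dense_subspace (S : set F) : lin_subspace S ->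
  (forall f, (forall h, S h -> ip f h = 0) -> f = 0) -> closure S = setT.
Proof.
move=> sS ort; apply/seteqP; split=> // f _.
have [] := @riesz S (fun h => ip f h) `|f| sS.
- by move=> a g h _ _; rewrite ipDr ipZr.
- by move=> h _; exact: normr_ip.
move=> y Sy fy; suff -> : f = y by [].
apply/eqP; rewrite -subr_eq0; apply/eqP/ort => h Sh.
by rewrite ipBl fy// subrr.
Qed.

Lemma norm_le_dense (S : set F) (k : F) (C : R) : 0 <= C -> closure S = setT ->
  (forall h, S h -> `|ip h k| <= C * `|h|) -> `|k| <= C.
Proof.
move=> C0 ST SC.
have : closure S k by rewrite ST.
rewrite closureEcvg => -[G GF [Gk GS]].
have Gk' : h @[h --> G] --> k by [].
have h1 : ip h k @[h --> G] --> ip k k by exact: cvg_ipl.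
have h2 : C * `|h| @[h --> G] --> C * `|k| by apply: cvgMr; exact: cvg_norm.
have : ip k k <= C * `|k|.
  have h3 : (C * `|h| - ip h k) @[h --> G] --> C * `|k| - ip k k by exact: cvgB.
  rewrite -subr_ge0; apply: (cvgr_to_ge h3).
  apply: filterS (GS S (fun x Sx => Sx)) => h Sh.
  by rewrite subr_ge0 (le_trans (ler_norm _))// SC.
have [->|k0] := eqVneq k 0; first by rewrite normr0.
by rewrite ip_norm expr2 ler_pM2r// normr_gt0.
Qed.

(** Gram-Schmidt, one step per element of [s]. The last clause puts [p] in the double orthogonal
    complement of [s], which stands in for membership in its span. *)
Lemma proj_seq (S : set F) (s : seq F) : lin_subspace S -> (forall v, v \in s -> S v) ->
  forall h, exists p, [/\ S p, forall v, v \in s -> ip (h - p) v = 0 &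
    forall x, (forall v, v \in s -> ip x v = 0) -> ip x p = 0].
Proof.
move=> sS; elim: s => [|v s IH] Ss h.
  by exists 0; split=> // [|x _]; [case: sS|rewrite ip0r].
have {}IH := IH (fun w ws => Ss w (mem_behead (s := v :: s) ws)).
have Sv : S v by apply: Ss; rewrite mem_head.
have [q [Sq vq sq]] := IH v; have [p [Sp hp sp]] := IH h.
(* If [w = 0], division by zero makes [c] zero, which is a correct coefficient. *)
pose w := v - q; pose c := ip (h - p) w / ip w w.
have cw : c * ip w w = ip (h - p) w.
  rewrite /c; have [->|w0] := eqVneq w 0; first by rewrite !ip0r mulr0.
  by rewrite divfK// ip_norm sqrf_eq0 normr_eq0.
have vE : v = w + q by rewrite /w subrK.
exists (p + c *: w); split.
- by apply: subspaceD => //; apply: subspaceZ => //; exact: subspaceB.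
- move=> u; rewrite inE opprD addrA ipBl ipZl => /predU1P[->|us].
    have -> : ip (h - p) v = ip (h - p) w by rewrite {1}vE ipDr sq ?addr0.
    have -> : ip w v = ip w w by rewrite {1}vE ipDr sq ?addr0.
    by rewrite cw subrr.
  by rewrite hp// vq// mulr0 subrr.
- move=> x xs; have xs' : forall u, u \in s -> ip x u = 0.
    by move=> u us; rewrite xs// inE us orbT.
  by rewrite ipDr sp// ipZr ipBr xs ?mem_head// sq// subrr mulr0 addr0.
Qed.

Definition weakly_to T (U : set_system T) (h : T -> F) (y : F) :=
  forall a, ip (h t) a @[t --> U] --> ip y a.

(** Lower semicontinuity of the norm, with a bound that varies along the filter: in the second-order
    cone constraints it is an affine function of the pair itself. *)
Lemma weakly_to_le_norm T (U : set_system T) {UF : ProperFilter U}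
    (h : T -> F) (y : F) (r : T -> R) (N : R) :
  weakly_to U h y -> (\forall t \near U, `|h t| <= r t) -> r t @[t --> U] --> N ->
  `|y| <= N.
Proof.
move=> hy hr rN.
have h2 : r t * `|y| @[t --> U] --> N * `|y| by apply: cvgMl.
have : ip y y <= N * `|y|.
  have h3 : (r t * `|y| - ip (h t) y) @[t --> U] --> N * `|y| - ip y y.
    by apply: cvgB => //; exact: hy.
  rewrite -subr_ge0; apply: (cvgr_to_ge h3).
  apply: filterS hr => t ht; rewrite subr_ge0 (le_trans (cauchy_schwarz _ _))//.
  by rewrite ler_wpM2r.
have [->|k0] := eqVneq y 0.
  move=> _; rewrite normr0; apply: (cvgr_to_ge rN); apply: filterS hr => t.
  exact: le_trans.
by rewrite ip_norm expr2 ler_pM2r// normr_gt0.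
Qed.

End Hilbert.

(** * Weak limits along ultrafilters *)

Lemma ultra_cvg_bounded (R : realType) T (U : set_system T) (UU : UltraFilter U)
    (x : T -> R) (M : R) :
  (\forall t \near U, `|x t| <= M) -> exists l : R, x t @[t --> U] --> l.
Proof.
move=> xM; have [|l [_ cl]] := @segment_compact R (- M) M (fmap x U) _.
  by apply: filterS xM => t; rewrite /= in_itv/= ler_norml.
exists l => A Al; have [//|UA] := in_ultra_setVsetC (x @^-1` A) UU.
by have [y []] := cl (~` A) A UA Al.
Qed.

Section Hilbert_ultra.
Context {R : realType} {F : completeNormedModType R} (ip : F -> F -> R).
Hypothesis ipC : forall f g, ip f g = ip g f.
Hypothesis ip_linear : forall a f g h, ip (a *: f + g) h = a * ip f h + ip g h.
Hypothesis ip_norm : forall f, ip f f = `|f| ^+ 2.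

Lemma ultra_weakly_to T (U : set_system T) (UU : UltraFilter U) (h : T -> F) (M : R) :
  (\forall t \near U, `|h t| <= M) -> exists y, weakly_to ip U h y.
Proof.
move=> hM.
have ex a : exists l : R, ip (h t) a @[t --> U] --> l.
  apply: (ultra_cvg_bounded UU (M := M * `|a|)).
  apply: filterS hM => t ht; apply: le_trans (normr_ip ipC ip_linear ip_norm _ _) _.
  exact: ler_wpM2r.
have [l lP] := choice ex.
have lM a : `|l a| <= M * `|a|.
  apply: (cvgr_to_le (cvg_norm (lP a))); apply: filterS hM => t ht.
  apply: le_trans (normr_ip ipC ip_linear ip_norm _ _) _; exact: ler_wpM2r.
have llin a f g : l (a *: f + g) = a * l f + l g.
  have h1 : ip (h t) (a *: f + g) @[t --> U] --> a * l f + l g.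
    rewrite (_ : (fun t => _) = fun t => a * ip (h t) f + ip (h t) g).
      by apply: cvgD; [apply: cvgMr|]; exact: lP.
    by apply/funext => t; rewrite ipC ip_linear !(ipC _ (h t)).
  exact: (cvg_unique (@Rhausdorff R) (lP _) h1).
have [|||y _ ly] := riesz ipC ip_linear ip_norm (S := setT) (l := l) (C := M) => //.
by exists y => a; rewrite -ly//; exact: lP.
Qed.

(** Let [z] represent [ip y] on [S]; closedness puts [z] in [S]. Then [y - z] is orthogonal to [S],
    hence to each [h t] and in the limit to [y], so its norm vanishes. *)
Lemma weakly_to_closed T (U : set_system T) {UF : ProperFilter U} (S : set F)
    (h : T -> F) y : lin_subspace S -> closed S ->
  (\forall t \near U, S (h t)) -> weakly_to ip U h y -> S y.
Proof.
move=> sS cS Sh hy.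
have [|||z Sz yz] := riesz ipC ip_linear ip_norm (S := S) (l := fun g => ip y g)
    (C := `|y|) => //.
  by move=> *; rewrite (ipDr ipC ip_linear) (ipZr ipC ip_linear).
  by move=> g _; exact: normr_ip.
have {}Sz : S z by rewrite (closure_id S).1.
have h0 : ip (h t) (y - z) @[t --> U] --> 0.
  apply/cvgrPdist_le => e e0; apply: filterS Sh => t St.
  by rewrite sub0r normrN (ipBr ipC ip_linear) !(ipC (h t)) yz// subrr normr0 ltW.
have y0 := cvg_unique (@Rhausdorff R) (hy (y - z)) h0.
suff -> : y = z by [].
apply/eqP; rewrite -subr_eq0 -normr_eq0 -sqrf_eq0 -ip_norm (ipBl ip_linear) y0.
by rewrite (ipBr ipC ip_linear) ipC yz// subrr subr0.
Qed.

End Hilbert_ultra.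

(** * Iterated directional derivatives *)

Section Directional_derivatives.
Context {R : realType} {V : normedModType R}.
Implicit Types (g : V -> R) (x e a : V).

Lemma growth_shift g a x e :
  (fun h : R => h^-1 *: (((fun y => g (y + a)) \o shift x) (h *: e) - g (x + a))) =
  (fun h : R => h^-1 *: ((g \o shift (x + a)) (h *: e) - g (x + a))).
Proof. by apply/funext => h /=; rewrite addrA. Qed.

Lemma derivable_shift g a x e :
  derivable g (x + a) e -> derivable (fun y => g (y + a)) x e.
Proof. by rewrite /derivable growth_shift. Qed.

Lemma derive_translate g a x e : 'D_e (fun y => g (y + a)) x = 'D_e g (x + a).
Proof. by rewrite /derive growth_shift. Qed.

Lemma is_derive_line g x e (t : R) : derivable g (x + t *: e) e ->
  is_derive t 1 (fun s => g (x + s *: e)) ('D_e g (x + t *: e)).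
Proof.
have gE : (fun h : R => h^-1 *: ((g \o shift (x + t *: e)) (h *: e) - g (x + t *: e)))
  = (fun h : R => h^-1 *:
      (((fun s => g (x + s *: e)) \o shift t) (h *: 1) - g (x + t *: e))).
  apply/funext => h /=; congr (_ *: (g _ - _)).
  by rewrite [h *: 1]mulr1 scalerDl addrCA.
move=> dg; split; first by rewrite /derivable -gE.
by rewrite /derive -gE.
Qed.

Lemma line_mvt g x e (u : R) :
  (forall t, `|t| <= `|u| -> derivable g (x + t *: e) e) ->
  exists t, `|t| <= `|u| /\ g (x + u *: e) - g x = u * 'D_e g (x + t *: e).
Proof.
move=> dg; pose f s := g (x + s *: e).
have fd (t : R) : `|t| <= `|u| -> is_derive t (1 : R) f ('D_e g (x + t *: e)).
  by move=> /dg; exact: is_derive_line.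
have f0 : f 0 = g x by rewrite /f scale0r addr0.
have fc (a b : R) : `|a| <= `|u| -> `|b| <= `|u| -> {within `[a, b], continuous f}.
  move=> au bu; apply: derivable_within_continuous => t; rewrite in_itv/= => /andP[h1 h2].
  have tu : `|t| <= `|u|.
    by move: au bu; rewrite !ler_norml => /andP[? ?] /andP[? ?]; apply/andP; split; lra.
  by have [] := fd _ tu.
have n0 : `|0 : R| <= `|u| by rewrite normr0.
have [u0|u0] := leP 0 u.
- have [t||t] := @MVT_segment R f (fun t => 'D_e g (x + t *: e)) 0 u u0.
  + rewrite in_itv/= => /andP[h1 h2]; apply: fd.
    by rewrite (ger0_norm u0) ger0_norm// ltW.
  + exact: fc.
  + rewrite in_itv/= => /andP[h1 h2] h; exists t; split.
      by rewrite (ger0_norm u0) ger0_norm.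
    by move: h; rewrite f0 subr0 mulrC.
- have [t||t] := @MVT_segment R f (fun t => 'D_e g (x + t *: e)) u 0 (ltW u0).
  + rewrite in_itv/= => /andP[h1 h2]; apply: fd.
    by rewrite (ltr0_norm u0) ltr0_norm// lerN2 ltW.
  + exact: fc.
  + rewrite in_itv/= => /andP[h1 h2] h; exists t; split.
      by rewrite (ltr0_norm u0) ler0_norm// lerN2.
    by move: h; rewrite f0 /f; lra.
Qed.

End Directional_derivatives.

Section Word_derivatives.
Context {R : realType} {d : nat}.
Implicit Types (f g : 'rV[R]_d -> R) (U V : set 'rV[R]_d) (w : seq 'I_d).

Lemma eq_in_derive U f g x e : open U -> (forall y, U y -> f y = g y) -> U x ->
  'D_e f x = 'D_e g x.
Proof.
move=> oU fg Ux; apply: near_eq_derive.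
by apply: filterS (open_nbhs_nbhs (conj oU Ux)).
Qed.

Lemma eq_in_derivable U f g x e : open U -> (forall y, U y -> f y = g y) -> U x ->
  derivable f x e -> derivable g x e.
Proof.
move=> oU fg Ux; apply: near_eq_derivable.
by apply: filterS (open_nbhs_nbhs (conj oU Ux)).
Qed.

(** Used with the interior of [X] as [U]: evaluations and inner products with kernel sections are
    only known to agree on [X]. *)
Lemma eq_in_wderiv U w f g : open U -> (forall y, U y -> f y = g y) ->
  forall x, U x -> wderiv w f x = wderiv w g x.
Proof.
move=> oU fg; elim: w => //= i w IH x Ux.
exact: (@eq_in_derive U).
Qed.

Lemma eq_in_wderivable U w f g : open U -> (forall y, U y -> f y = g y) ->
  wderivable U w f -> wderivable U w g.
Proof.
move=> oU fg; elim: w => [//|i w IH] [/IH wg dw].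
split; [exact: wg|move=> x Ux].
apply: (@eq_in_derivable U (wderiv w f)) (dw x Ux) => //.
exact: eq_in_wderiv.
Qed.

Lemma wderivableW U V w f : V `<=` U -> wderivable U w f -> wderivable V w f.
Proof. by move=> VU; elim: w => //= i w IH [/IH ? h]; split=> // x /VU/h. Qed.

Lemma wderiv_translate w g a :
  wderiv w (fun y => g (y + a)) = (fun y => wderiv w g (y + a)).
Proof.
by elim: w => //= i w ->; apply/funext => x; rewrite derive_translate.
Qed.

Lemma wderivable_translate U V w g a : (forall y, V y -> U (y + a)) ->
  wderivable U w g -> wderivable V w (fun y => g (y + a)).
Proof.
move=> VU; elim: w => //= i w IH [/IH ? h]; split=> // x /VU/h.
by rewrite wderiv_translate; exact: derivable_shift.
Qed.

Lemma wderiv_linear U w f g (a : R) : open U ->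
  wderivable U w f -> wderivable U w g ->
  wderivable U w (fun x => a * f x + g x) /\
  forall x, U x -> wderiv w (fun x => a * f x + g x) x = a * wderiv w f x + wderiv w g x.
Proof.
move=> oU; elim: w => [//|i w IH] [/IH{}IH df] [/IH[{}IH IHE] dg].
have H x : U x -> is_derive x 'e_i (fun x => a * wderiv w f x + wderiv w g x)
     (a * 'D_('e_i) (wderiv w f) x + 'D_('e_i) (wderiv w g) x).
  move=> Ux; have df1 := derivableP (df _ Ux); have dg1 := derivableP (dg _ Ux).
  exact: (is_deriveD (is_deriveZ a df1) dg1).
split; [split; [exact: IH|move=> x Ux]|move=> x Ux /=].
  have [h _] := H x Ux.
  by apply: (@eq_in_derivable U) h => // y Uy; rewrite IHE.
have [_ <-] := H x Ux; exact: (@eq_in_derive U).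
Qed.

Lemma wderiv0 U w : open U -> wderivable U w (fun=> 0) /\
  forall x, U x -> wderiv w (fun=> 0) x = 0.
Proof.
move=> oU; elim: w => [//|i w [IH IHE]]; split; [split; [exact: IH|move=> x Ux]|move=> x Ux /=].
  by apply: (@eq_in_derivable U) (derivable_cst 0 x 'e_i) => // y /IHE.
by rewrite (@eq_in_derive U _ (cst 0))// derive_cst.
Qed.

Lemma wderivZB U w f g (a : R) : open U ->
  wderivable U w f -> wderivable U w g ->
  wderivable U w (fun x => a * (f x - g x)) /\
  forall x, U x -> wderiv w (fun x => a * (f x - g x)) x = a * (wderiv w f x - wderiv w g x).
Proof.
move=> oU df dg; have [d0 d0E] := wderiv0 w oU.
have [d1 d1E] := wderiv_linear (- a) oU dg d0.
have [d2 d2E] := wderiv_linear a oU df d1.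
have -> : (fun x => a * (f x - g x)) = fun x => a * f x + (- a * g x + 0).
  by apply/funext => x; ring.
split=> // x Ux; rewrite d2E// d1E// d0E//; ring.
Qed.

End Word_derivatives.

(** * Iterated difference quotients *)

Section Iterated_differences.
Context {R : realType} {d : nat}.
Implicit Types (x y : 'rV[R]_d) (u : R) (ws : seq ('I_d * R)).

Lemma ball_step y a eps x u (i : 'I_d) : `|u| <= eps -> ball y a x ->
  ball y (a + eps) (x + u *: 'e_i).
Proof.
move=> ue [a0 yx]; split; first by rewrite ltr_wpDr// (le_trans _ ue).
move=> p q; have := yx p q; rewrite /ball/= !mxE => h.
have e1 : `|((p == 0) && (q == i))%:R : R| <= 1 by case: (_ && _); rewrite ?normr1 ?normr0.
rewrite opprD addrA (le_lt_trans (ler_normB _ _))// ltr_leD// normrM.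
by rewrite (le_trans _ ue)// ler_piMr.
Qed.

Definition dq (V : lmodType R) (iu : 'I_d * R) (E : 'rV[R]_d -> V) x : V :=
  iu.2^-1 *: (E (x + iu.2 *: 'e_(iu.1)) - E x).

(** The head of the list is the innermost quotient, whereas the head of a word is the outermost
    derivative in [wderiv]. This lets the inductions below treat the head by one mean value or one
    limit applied to [wderiv w g], without interchanging partial derivatives. *)
Fixpoint idiff (V : lmodType R) ws (E : 'rV[R]_d -> V) : 'rV[R]_d -> V :=
  if ws is iu :: ws' then idiff ws' (dq iu E) else E.

Definition small (eps : R) ws := all (fun iu => (iu.2 != 0) && (`|iu.2| <= eps)) ws.

Lemma idiff_morph (V W : lmodType R) (h : V -> W) ws (E : 'rV[R]_d -> V) x :
  (forall a v w, h (a *: (v - w)) = a *: (h v - h w)) ->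
  h (idiff ws E x) = idiff ws (h \o E) x.
Proof.
move=> hlin; elim: ws E => //= iu ws IH E; rewrite IH; congr (idiff ws _ x).
by apply/funext => y; rewrite /= /dq hlin.
Qed.

Lemma idiffZB (V : lmodType R) ws a (E G : 'rV[R]_d -> V) x :
  idiff ws (fun y => a *: (E y - G y)) x = a *: (idiff ws E x - idiff ws G x).
Proof.
elim: ws E G => //= iu ws IH E G; rewrite -IH; congr (idiff ws _ x).
apply/funext => y; rewrite /dq -!scalerBr !scalerA (mulrC a); congr (_ *: _).
by rewrite !opprB (addrC (G _)) addrACA (addrC (- _) (G _)).
Qed.

Lemma idiff_swap (V : lmodType R) ws ws' (k : 'rV[R]_d -> 'rV[R]_d -> V) x x' :
  idiff ws (fun p => idiff ws' (k p) x') x =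
  idiff ws' (fun b => idiff ws (fun p => k p b) x) x'.
Proof.
elim: ws k => //= iu ws IH k; rewrite -(IH (fun p b => dq iu (fun p => k p b) p)).
by congr (idiff ws _ x); apply/funext => p; rewrite /dq idiffZB.
Qed.

Lemma idiff_eq_in (V : lmodType R) ws eps y a (E G : 'rV[R]_d -> V) x :
  0 <= eps -> small eps ws -> ball y a x ->
  (forall p, ball y (a + eps *+ size ws) p -> E p = G p) ->
  idiff ws E x = idiff ws G x.
Proof.
move=> eps0; elim: ws E G => /= [|iu ws IH] E G.
  by move=> _ yx EG; apply: EG; rewrite addr0.
move=> /andP[/andP[u0 ue] se] yx EG; apply: IH => // p yp.
rewrite /dq !EG//; last by rewrite mulrSr addrA; exact: ball_step.
by apply: le_ball yp; rewrite lerD2l mulrS lerDr.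
Qed.

Lemma wderiv_dq U V w i u (g : 'rV[R]_d -> R) : open V ->
  (forall x, V x -> U x /\ U (x + u *: 'e_i)) -> wderivable U w g ->
  wderivable V w (dq (i, u) (g : _ -> R^o)) /\
  forall x, V x -> wderiv w (dq (i, u) (g : _ -> R^o)) x =
     u^-1 * (wderiv w g (x + u *: 'e_i) - wderiv w g x).
Proof.
move=> oV VU dg.
have d1 : wderivable V w g by apply: wderivableW dg => x /VU[].
have d2 : wderivable V w (fun x => g (x + u *: 'e_i)).
  by apply: wderivable_translate dg => x /VU[].
have [d3 d3E] := wderivZB u^-1 oV d2 d1.
by split=> // x Vx; rewrite d3E// wderiv_translate.
Qed.

(** Each quotient costs one application of the mean value theorem and moves the point by at most
    [eps] along an axis, which accounts for the enlarged radius. *)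
Lemma mvt_idiff ws eps y a (g : 'rV[R]_d -> R^o) x : 0 <= eps -> small eps ws ->
  wderivable (ball y (a + eps *+ size ws)) (unzip1 ws) g -> ball y a x ->
  exists2 x', ball y (a + eps *+ size ws) x' & idiff ws g x = wderiv (unzip1 ws) g x'.
Proof.
move=> eps0; elim: ws g => /= [|[i u] ws IH] g.
  by move=> _ _ yx; exists x => //; rewrite addr0.
set n := a + _; set n' := a + _ in IH.
move=> /andP[/= /andP[u0 ue] se] [dg dg1] yx.
have nn' : n = n' + eps by rewrite /n mulrSr addrA.
have VU p : ball y n' p -> ball y n p /\ ball y n (p + u *: 'e_i).
  move=> yp; rewrite nn'; split; last exact: ball_step.
  by apply: le_ball yp; rewrite lerDl.
have [dd ddE] := wderiv_dq (ball_open _ _) VU dg.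
have [x1 yx1 ->] := IH _ se dd yx.
rewrite ddE//.
have [t|t [tu ->]] := @line_mvt _ _ (wderiv (unzip1 ws) g) x1 'e_i u.
  by move=> tu; apply: dg1; rewrite nn'; apply: ball_step => //; exact: le_trans ue.
exists (x1 + t *: 'e_i); last by rewrite mulKf.
by rewrite nn'; apply: ball_step => //; exact: le_trans ue.
Qed.

(** The outermost derivative is a limit of quotients of [wderiv w g]; each of them is [wderiv w] of
    a quotient of [g], to which the induction hypothesis applies before the limit. *)
Lemma wderiv_bound w eps y a (g : 'rV[R]_d -> R^o) x (M : R) : 0 < eps ->
  wderivable (ball y (a + eps *+ size w)) w g -> ball y a x ->
  (forall ws, unzip1 ws = w -> small eps ws -> `|idiff ws g x| <= M) ->
  `|wderiv w g x| <= M.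
Proof.
move=> eps0; elim: w g => [|i w IH] g; first by move=> _ _ /(_ [::]); exact.
rewrite /=; set n := a + _; set n' := a + _ in IH.
move=> [dg dg1] yx gM.
have nn' : n = n' + eps by rewrite /n mulrSr addrA.
have n'x : ball y n' x by apply: le_ball yx; rewrite lerDl mulrn_wge0// ltW.
have nx : ball y n x by apply: le_ball n'x; rewrite nn' lerDl ltW.
have {}dg1 : derivable (wderiv w g) x 'e_i by exact: dg1.
apply: (cvgr_to_le (cvg_norm dg1)).
near=> h.
have h0 : h != 0 by near: h; exact: nbhs_dnbhs_neq.
have he : `|h| <= eps by near: h; exact: dnbhs0_le.
have VU p : ball y n' p -> ball y n p /\ ball y n (p + h *: 'e_i).
  move=> yp; rewrite nn'; split; last exact: ball_step.
  by apply: le_ball yp; rewrite lerDl ltW.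
have [dd ddE] := wderiv_dq (ball_open _ _) VU dg.
have := IH _ dd yx; rewrite ddE// /= (addrC x); apply=> ws wsE sws.
by apply: (gM ((i, h) :: ws)); rewrite /= ?wsE// h0 he.
Unshelve. all: by end_near.
Qed.

Lemma wderiv_idiff V w ws eps y a (k : 'rV[R]_d -> 'rV[R]_d -> R) x : open V ->
  0 <= eps -> small eps ws -> ball y a x ->
  (forall p, ball y (a + eps *+ size ws) p -> wderivable V w (k p)) ->
  wderivable V w (fun b => idiff ws (k^~ b : _ -> R^o) x) /\
  forall b, V b -> wderiv w (fun b => idiff ws (k^~ b : _ -> R^o) x) b =
                 idiff ws (fun p => wderiv w (k p) b : R^o) x.
Proof.
move=> oV eps0 + yx; elim: ws k => [k _|[i u] ws IH k].
  by move=> /(_ x); rewrite addr0 => /(_ yx).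
rewrite /=; set n := a + _; set n' := a + _ in IH.
move=> /andP[/andP[/= u0 ue] se] dk.
have nn' : n = n' + eps by rewrite /n mulrSr addrA.
have VU p : ball y n' p -> ball y n p /\ ball y n (p + u *: 'e_i).
  move=> yp; rewrite nn'; split; last exact: ball_step.
  by apply: le_ball yp; rewrite lerDl.
pose k' p b : R := u^-1 * (k (p + u *: 'e_i) b - k p b).
have k'E p : ball y n' p -> wderivable V w (k' p) /\ forall b, V b ->
    wderiv w (k' p) b = u^-1 * (wderiv w (k (p + u *: 'e_i)) b - wderiv w (k p) b).
  by move=> /VU[/dk k1 /dk k2]; exact: wderivZB.
have [d1 d1E] := IH k' se (fun p yp => (k'E p yp).1).
split=> // b Vb; rewrite [LHS]d1E//.
by apply: (@idiff_eq_in _ _ eps y a) => // p /k'E[_ ->].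
Qed.

End Iterated_differences.

Section Difference_norm.
Context {R : realType} {F : completeNormedModType R} (ip : F -> F -> R).
Hypothesis ipC : forall f g, ip f g = ip g f.
Hypothesis ip_linear : forall a f g h, ip (a *: f + g) h = a * ip f h + ip g h.
Hypothesis ip_norm : forall f, ip f f = `|f| ^+ 2.
Context {d : nat} (E : 'rV[R]_d -> F).

Lemma ip_idiff ws f x : ip f (idiff ws E x) = idiff ws (fun p => ip f (E p) : R^o) x.
Proof.
apply: (@idiff_morph _ _ _ R^o) => a v w.
by rewrite (ipZr ipC ip_linear) (ipBr ipC ip_linear).
Qed.

Lemma idiff_norm w (U : set 'rV[R]_d) y a eps M x : open U -> 0 <= eps ->
  ball y (a + eps *+ size w) `<=` U ->
  (forall p, U p -> wderivable U w (fun b => ip (E p) (E b))) ->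
  (forall b, U b -> wderivable U w (fun p => wderiv w (fun b => ip (E p) (E b)) b)) ->
  (forall p b, ball y (a + eps *+ size w) p -> ball y (a + eps *+ size w) b ->
    `|wderiv w (fun p => wderiv w (fun b => ip (E p) (E b)) b) p| <= M) ->
  ball y a x -> forall ws, unzip1 ws = w -> small eps ws ->
  `|idiff ws E x| ^+ 2 <= M.
Proof.
move=> oU eps0 BU dk dk2 kM yx ws wsE sws.
rewrite -ip_norm ip_idiff.
have sz : size ws = size w by rewrite -wsE size_map.
pose k p b : R := ip (E p) (E b).
have -> : (fun p => ip (idiff ws E x) (E p)) =
    fun p => idiff ws (fun b => k p b : R^o) x.
  by apply/funext => p; rewrite ipC ip_idiff.
rewrite idiff_swap.
(* With the outer difference now in [b], the mean value theorem is used in the second argument of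
   [k] first and in the first one afterwards, the order in which the derivatives are assumed to
   exist. *)
set B := ball y _ in BU kM.
have Bk p : B p -> wderivable U w (k p) by move=> /BU; exact: dk.
have [] := @wderiv_idiff _ _ U w ws eps y a k x oU eps0 sws yx.
  by rewrite sz.
move=> d1 d1E.
have [|b Bb ->] := mvt_idiff eps0 sws (y := y) (a := a) (x := x) _ yx (g := fun b => idiff ws (k^~ b : _ -> R^o) x).
  by rewrite sz wsE; apply: wderivableW d1.
rewrite sz in Bb.
rewrite wsE d1E; last exact: BU.
have [|p Bp ->] := mvt_idiff eps0 sws (y := y) (a := a) (x := x) _ yx (g := fun p => wderiv w (k p) b).
  by rewrite sz wsE; apply: wderivableW (dk2 b (BU _ Bb)).
rewrite sz in Bp.
by rewrite wsE (le_trans (ler_norm _))// kM.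
Qed.

End Difference_norm.

(** * Derivatives in a reproducing kernel space *)

Section Derivative_representers.
Context {R : realType} {F : completeNormedModType R} (ip : F -> F -> R).
Hypothesis ipC : forall f g, ip f g = ip g f.
Hypothesis ip_linear : forall a f g h, ip (a *: f + g) h = a * ip f h + ip g h.
Hypothesis ip_norm : forall f, ip f f = `|f| ^+ 2.
Context {d : nat} (E : 'rV[R]_d -> F) (U : set 'rV[R]_d) (G : set F).
Hypothesis oU : open U.
Hypothesis G_total : forall f, (forall g, G g -> ip f g = 0) -> f = 0.

Let k p b : R := ip (E p) (E b).

(** What class C^{s,s} provides for one word: the clause on the total set [G] makes [wsmooth w]
    dense, and the local bound on the derivative by [w] in both arguments bounds the evaluation of
    derivatives on it. *)
Definition regular w :=
  [/\ forall g, G g -> wderivable U w (fun b => ip g (E b)),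
      forall p, U p -> wderivable U w (k p),
      forall b, U b -> wderivable U w (fun p => wderiv w (k p) b) &
      forall y, U y -> exists M rho, [/\ 0 < rho, ball y rho `<=` U &
        forall p b, ball y rho p -> ball y rho b ->
          `|wderiv w (fun p => wderiv w (k p) b) p| <= M]].

Definition wsmooth w : set F := [set f | wderivable U w (fun b => ip f (E b))].

Lemma ip_section_linear a f g :
  (fun b => ip (a *: f + g) (E b)) = (fun b => a * ip f (E b) + ip g (E b)).
Proof. by apply/funext => b; rewrite ip_linear. Qed.

Lemma wsmooth_subspace w : lin_subspace (wsmooth w).
Proof.
split=> [|a f g Sf Sg]; rewrite /wsmooth /=.
  rewrite (_ : (fun b => _) = (fun=> 0)); first exact: (wderiv0 w oU).1.
  by apply/funext => b; rewrite (ip0l ip_linear).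
rewrite ip_section_linear; exact: (wderiv_linear a oU Sf Sg).1.
Qed.

Lemma wsmooth_dense w : regular w -> closure (wsmooth w) = setT.
Proof.
move=> [Gw _ _ _]; apply: (dense_subspace ipC ip_linear ip_norm (wsmooth_subspace w)).
by move=> f fS; apply: G_total => g /Gw; exact: fS.
Qed.

Lemma wderiv_locally_bounded w y : regular w -> U y ->
  exists C rho : R, [/\ 0 <= C, 0 < rho, ball y rho `<=` U &
    forall b h, ball y rho b -> wsmooth w h ->
      `|wderiv w (fun b => ip h (E b)) b| <= C * `|h|].
Proof.
move=> [_ dk dk2 kM] /kM[M [rho [rho0 yU kM']]].
have rho2 : 0 < rho / 2 by rewrite divr_gt0.
(* Starting within [rho / 2] of [y], all [size w] steps of length at most [eps] stay within
   [rho]. *)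
pose eps : R := rho / 2 / (size w).+1%:R.
have eps0 : 0 < eps by rewrite divr_gt0.
have le_rho : rho / 2 + eps *+ size w <= rho.
  have : eps *+ (size w).+1 = rho / 2.
    by rewrite -[_ *+ (size w).+1]mulr_natr divfK ?pnatr_eq0.
  by rewrite mulrSr; lra.
have sub p : ball y (rho / 2 + eps *+ size w) p -> ball y rho p by exact: le_ball.
exists (Num.sqrt M), (rho / 2); split=> //.
  by move=> p yp; apply: yU; apply: le_ball yp; lra.
move=> b h yb Sh.
apply: (wderiv_bound eps0 (y := y) (a := rho / 2)) => //.
  by apply: wderivableW Sh => p /sub/yU.
move=> ws wsE sws; rewrite -(ip_idiff ipC ip_linear).
rewrite (le_trans (normr_ip ipC ip_linear ip_norm _ _))// mulrC ler_wpM2r//.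
rewrite -ler_sqr ?nnegrE ?sqrtr_ge0//.
have nM : `|idiff ws E b| ^+ 2 <= M.
  apply: (idiff_norm ipC ip_linear ip_norm oU (ltW eps0) (w := w) (y := y) (a := rho / 2)) => //.
    by move=> p /sub/yU.
  by move=> p q /sub yp /sub yq; exact: kM'.
by rewrite sqr_sqrtr// (le_trans _ nM).
Qed.

(** Induction on the word, hence regularity of every suffix. The quotients of the representer [kap]
    of the shorter word converge when tested on the dense [S] and are bounded in norm, so they
    converge weakly. *)
Lemma derivative_representer w :
  (forall w1 w2, w = w1 ++ w2 -> regular w2) ->
  exists kappa : 'rV[R]_d -> F, forall f, wsmooth w f /\
    forall b, U b -> wderiv w (fun b => ip f (E b)) b = ip f (kappa b).
Proof.
elim: w => [_|i w IH reg]; first by exists E.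
have [|kap kapP] := IH; first by move=> w1 w2 wE; apply: (reg (i :: w1)); rewrite wE.
have regw : regular (i :: w) by exact: (reg [::]).
pose S := wsmooth (i :: w); pose e : 'rV[R]_d := 'e_i.
have sS : lin_subspace S := wsmooth_subspace _.
have ST : closure S = setT := wsmooth_dense regw.
pose D h := wderiv (i :: w) (fun b => ip h (E b)).
suff H y : U y -> exists ky : F, forall f,
    (fun t : R => ip f (t^-1 *: (kap (t *: e + y) - kap y))) t @[t --> 0^'] --> ip f ky.
  have kyE : exists k1 : 'rV[R]_d -> F, forall y f, U y ->
      is_derive y e (fun b => ip f (kap b)) (ip f (k1 y)).
    have : forall y, exists ky : F, U y -> forall f,
      is_derive y e (fun b => ip f (kap b)) (ip f ky).
      move=> y; have [Uy|nUy] := pselect (U y); last by exists 0.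
      have [ky kyP] := H y Uy; exists ky => _ f.
      have gE : (fun h : R => h^-1 *: (((fun b => ip f (kap b)) \o shift y) (h *: e) -
            ip f (kap y))) =
          fun t => ip f (t^-1 *: (kap (t *: e + y) - kap y)).
        by apply/funext => t; rewrite (ipZr ipC ip_linear) (ipBr ipC ip_linear).
      split; first by rewrite /derivable gE; apply: cvgP; exact: kyP.
      rewrite /derive gE; apply: cvg_lim => //; exact: kyP.
    move=> /choice[k1 k1P]; exists k1 => y f Uy; exact: k1P.
  have [k1 k1P] := kyE; exists k1 => f.
  have [Sf fE] := kapP f.
  split; [split; [exact: Sf|move=> x Ux]|move=> x Ux /=].
    have [h _] := k1P x f Ux.
    by apply: (@eq_in_derivable _ _ U) h => // z Uz; rewrite fE.
  by have [_ <-] := k1P x f Ux; exact: (@eq_in_derive _ _ U).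
move=> Uy.
have [C [rho [C0 rho0 yU SC]]] := wderiv_locally_bounded regw Uy.
have yy : ball y rho y by exact: ballxx.
have [|h Sh|ky _ kyE] := @riesz _ _ ip ipC ip_linear ip_norm S (fun h => D h y) C sS.
- move=> a f g Sf Sg; rewrite /D ip_section_linear.
  exact: (wderiv_linear a oU Sf Sg).2.
- exact: SC.
exists ky => f.
pose Dl t := t^-1 *: (kap (t *: e + y) - kap y).
have ipDl_ h t : U (t *: e + y) -> ip h (Dl t) =
    t^-1 * (wderiv w (fun b => ip h (E b)) (t *: e + y) - wderiv w (fun b => ip h (E b)) y).
  by move=> Ut; rewrite (ipZr ipC ip_linear) (ipBr ipC ip_linear) -!(kapP h).2.
have step t s : `|t| < rho -> `|s| <= `|t| -> ball y rho (y + s *: e).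
  move=> tr st; have rt : 0 < rho - `|t| by rewrite subr_gt0.
  have rE : rho = (rho - `|t|) + `|t| by rewrite subrK.
  by rewrite rE; apply: ball_step => //; exact: ballxx.
(* Testing on [S] suffices for a norm bound; there the mean value theorem turns the quotient into a
   value of the derivative bounded by [C]. *)
have DlC t : t != 0 -> `|t| < rho -> `|Dl t| <= C.
  move=> t0 tr; apply: (norm_le_dense ipC ip_linear ip_norm C0 ST) => h Sh.
  have st s : `|s| <= `|t| -> ball y rho (y + s *: e) by exact: step.
  rewrite ipDl_; last by rewrite addrC; apply: yU; exact: st.
  have [|s [se]] := @line_mvt _ _ (wderiv w (fun b => ip h (E b))) y e t.
    by move=> s /st ys; apply: Sh.2; exact: yU.
  rewrite (addrC y (t *: e)) => ->; rewrite mulKf//; apply: SC => //; exact: st.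
apply/cvgrPdist_le => eps eps0.
(* Half of [eps] goes to the quotient at [h], the other half to [f - h] tested against [ky] and
   [Dl t], whose norms add up to at most [C] plus that of [ky]; the added 1 keeps the denominator
   positive. *)
pose del := eps / 2 / (C + `|ky| + 1).
have c1 : 0 < C + `|ky| + 1 by rewrite ltr_wpDl// addr_ge0.
have del0 : 0 < del by rewrite !divr_gt0.
have : closure S f by rewrite ST.
move=> /(_ (ball f del) (nbhsx_ballx _ _ del0))[h [Sh]]; rewrite -ball_normE /= => fh.
have hD : derivable (wderiv w (fun b => ip h (E b))) y e by exact: Sh.2.
have hDE : lim (t^-1 *: ((wderiv w (fun b => ip h (E b)) \o shift y) (t *: e) -
   wderiv w (fun b => ip h (E b)) y) @[t --> 0^']) = ip h ky by rewrite (ipC h) -kyE.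
have /cvgrPdist_le := hD; rewrite hDE => hD'.
have := hD' (eps / 2); rewrite divr_gt0// => /(_ isT) hD2.
near=> t.
have t0 : t != 0 by near: t; exact: nbhs_dnbhs_neq.
have tr : `|t| < rho by near: t; exact: dnbhs0_lt.
have h2 : `|ip h ky - ip h (Dl t)| <= eps / 2.
  rewrite ipDl_; first by near: t.
  by rewrite addrC; apply: yU; apply: step tr _.
rewrite (_ : ip f ky - ip f (Dl t) =
   ip (f - h) ky + (ip h ky - ip h (Dl t)) - ip (f - h) (Dl t)); last first.
  by rewrite !(ipBl ip_linear); ring.
rewrite (le_trans (ler_normB _ _))// (le_trans (lerD (ler_normD _ _) (lexx _)))//.
have b1 := normr_ip ipC ip_linear ip_norm (f - h) ky.
have b2 := normr_ip ipC ip_linear ip_norm (f - h) (Dl t).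
have b3 : `|f - h| * `|Dl t| <= `|f - h| * C by rewrite ler_wpM2l// DlC.
have b4 : `|f - h| * (C + `|ky| + 1) <= eps / 2.
  by rewrite -ler_pdivlMr// ltW.
have := normr_ge0 (f - h); lra.
Unshelve. all: by end_near.
Qed.

End Derivative_representers.

(** * Words attached to multiindices *)

Section Multiindices.
Context {d : nat}.
Implicit Types (r : multiindex d).

Lemma size_mword r : size (mword r) = mdeg r.
Proof.
rewrite /mword size_flatten /shape -map_comp sumnE big_map /mdeg -big_enum /=.
by apply: eq_bigr => i _; rewrite size_nseq.
Qed.

(** The letters of [mword r] follow the enumeration of the indices, so [i] is the first index with
    [r i] positive, and lowering [r] there by one deletes exactly this letter. *)
Lemma mword_behead r i w : mword r = i :: w ->
  exists r', mword r' = w /\ (mdeg r' <= mdeg r)%N.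
Proof.
pose r' : multiindex d := [ffun j => (r j - (j == i))%N].
move=> rw; exists r'; split; last first.
  by apply: leq_sum => j _; rewrite ffunE leq_subr.
move: rw; rewrite /mword; elim: (enum 'I_d) (enum_uniq 'I_d) => //= a s IH /andP[as_ us].
case ra: (r a) => [|n] /=.
  by move=> /IH -> //; rewrite ffunE ra.
move=> [ai <-]; rewrite ffunE ra -ai eqxx subSS subn0; congr (_ ++ _).
congr flatten; apply/eq_in_map => j js; rewrite ffunE -ai.
by case: eqP => [ja|]; [rewrite -ja js in as_|rewrite subn0].
Qed.

(** Needed because [derivative_representer] asks about suffixes of a word, while [Css] speaks of
    multiindices. *)
Lemma mword_suffix r w1 w2 : mword r = w1 ++ w2 ->
  exists r', mword r' = w2 /\ (mdeg r' <= mdeg r)%N.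
Proof.
elim: w1 r => [|i w1 IH] r /= rw; first by exists r.
have [r1 [/IH[r' [rw' r'r1]] r1r]] := mword_behead rw.
by exists r'; split=> //; exact: leq_trans r1r.
Qed.

End Multiindices.

(** * Extension of derivatives to boundary points *)

Section Extension.
Context {R : realType} {d : nat} (X : set 'rV[R]_d).

Lemma eq_in_lim_within (T : topologicalType) (U : set T) (h h' : T -> R) (x : T) :
  (forall y, U y -> h y = h' y) ->
  lim (h @ within U (nbhs x)) = lim (h' @ within U (nbhs x)).
Proof.
move=> hh'; congr lim; apply/seteqP.
by split=> A; apply: filterS2 (withinT U (nbhs_filter x)) => y /hh';
  rewrite /preimage /=; [move=> ->|move=> <-].
Qed.

Lemma eq_in_pderivX r (f g : 'rV[R]_d -> R) x : X x ->
  (forall y, X y -> f y = g y) -> pderivX X r f x = pderivX X r g x.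
Proof.
move=> Xx fg; rewrite /pderivX; case: ifP => _; first exact: fg.
have fgw y : X° y -> pderiv r f y = pderiv r g y.
  by apply: eq_in_wderiv; [exact: open_interior|move=> z /interior_subset; exact: fg].
rewrite /extend_lim; case: ifPn; first by rewrite inE => /fgw.
by move=> _; exact: eq_in_lim_within.
Qed.

Lemma pderiv2X_interior r k z : (X° `*` X°) z -> pderiv2X X r k z = pderiv2 r k z.
Proof.
move=> Xz; rewrite /pderiv2X /extend_lim; case: ifPn => [|_].
  rewrite -size_mword /pderiv2 /pderiv => /nilP ->; by [].
by rewrite mem_set.
Qed.

End Extension.

Section Dot_product.
Context {R : realType} {F : completeNormedModType R} (ip : {dot F for idfun}).

Lemma dot_sym f g : ip f g = ip g f.
Proof. by rewrite hermC expr0 mul1r. Qed.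

Lemma dot_linear a f g h : ip (a *: f + g) h = a * ip f h + ip g h.
Proof. by rewrite linearDl linearZl_LR. Qed.

End Dot_product.

Section Gram.
Context {R : realType} {F : completeNormedModType R} (ip : F -> F -> R).
Hypothesis ipC : forall f g, ip f g = ip g f.
Hypothesis ip_linear : forall a f g h, ip (a *: f + g) h = a * ip f h + ip g h.
Hypothesis ip_norm : forall f, ip f f = `|f| ^+ 2.
Context {T : topologicalType} (kap : T -> F) (Y : set T) (x : T) (c : R).
Hypothesis gram : forall e, 0 < e -> exists2 N, nbhs x N &
  forall a b, (N `&` Y) a -> (N `&` Y) b -> `|ip (kap a) (kap b) - c| <= e.

(** In the expansion of the squared distance the limits [c], [- 2 * c] and [c] cancel, and the
    errors add up to four times [e ^+ 2 / 4]. *)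
Lemma gram_close e : 0 < e -> exists2 N, nbhs x N &
  forall a b, (N `&` Y) a -> (N `&` Y) b -> `|kap a - kap b| <= e.
Proof.
move=> e0; have e4 : 0 < e ^+ 2 / 4 by rewrite divr_gt0// exprn_gt0.
have [N Nx NP] := gram e4; exists N => // a b Na Nb.
rewrite -ler_sqr ?nnegrE ?(ltW e0)// (normD_sqr ipC ip_linear ip_norm).
rewrite normrN (ipNr ipC ip_linear) -!ip_norm.
have := NP a a Na Na; have := NP a b Na Nb; have := NP b b Nb Nb.
rewrite !ler_norml => /andP[? ?] /andP[? ?] /andP[? ?]; lra.
Qed.

Lemma gram_cvg : ProperFilter (within Y (nbhs x)) ->
  exists l : F, kap a @[a --> within Y (nbhs x)] --> l.
Proof.
move=> PF; exists (lim (kap a @[a --> within Y (nbhs x)])).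
apply: cauchy_cvg; apply/cauchy_exP => e e0.
have e2 : 0 < e / 2 by rewrite divr_gt0.
have [N Nx NP] := gram_close e2.
have NY : within Y (nbhs x) (N `&` Y) by apply: filterS Nx => y.
have [b Nb] := filter_ex NY.
exists (kap b); apply: filterS NY => a Na; rewrite /preimage/= -ball_normE /=.
by rewrite (le_lt_trans (NP _ _ Nb Na))//; lra.
Qed.

End Gram.

(** * Reproducing property of differential operators *)

Section Reproducing.
Context {R : realType} {d Q s : nat} (X : set 'rV[R]_d).
Hypothesis hX : X `<=` closure X°.
Context (K : 'rV[R]_d -> 'rV[R]_d -> 'M[R]_Q).
Hypotheses (hK : matrix_kernel X K) (hKs : Css X s K).
Context (F : completeNormedModType R) (ip : {dot F for idfun}).
Context (ev : F -> 'rV[R]_d -> 'cV[R]_Q).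
Hypothesis hF : is_rkhs X K ip ev.

Let ipC := dot_sym ip.
Let ip_linear := dot_linear ip.
Let ip_norm := rkhs_normE hF.

Lemma cvdot_delta (u : 'cV[R]_Q) q : cvdot u (delta_mx q 0) = u q 0.
Proof.
by rewrite /cvdot -colE !mxE.
Qed.

(** The element K(., x) e_q. The default 0 can only occur for [x] outside [X]. *)
Definition section_elt q x : F :=
  xget 0 [set k | (forall y, X y -> ev k y = K y x *m delta_mx q 0) /\
                  forall f, ip f k = ev f x q 0].

Local Notation E := section_elt.

Lemma section_eltP q x : X x ->
  (forall y, X y -> ev (E q x) y = K y x *m delta_mx q 0) /\
  forall f, ip f (E q x) = ev f x q 0.
Proof.
move=> Xx; rewrite /section_elt; case: xgetP => [k _ //|nk].
have [k k1 k2] := rkhs_reproducing hF (delta_mx q 0) Xx.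
by exfalso; apply: (nk k); split=> // f; rewrite k2 cvdot_delta.
Qed.

Lemma ip_section f q x : X x -> ip f (E q x) = ev f x q 0.
Proof. by move=> /(section_eltP q)[]. Qed.

Lemma ip_sections p q x y : X x -> X y -> ip (E p x) (E q y) = K x y p q.
Proof.
move=> Xx Xy; rewrite ip_section//; have [-> // _] := section_eltP p Xx.
by rewrite -colE (hK.1 x y)// !mxE.
Qed.

Lemma Css_near r p q x e : (mdeg r <= s)%N -> X x -> 0 < e -> exists2 N, nbhs x N &
  forall a b, (N `&` X) a -> (N `&` X) b ->
   `|pderiv2X X r (fun x y => K x y p q) (a, b) -
     pderiv2X X r (fun x y => K x y p q) (x, x)| <= e.
Proof.
move=> rs Xx e0; have [_ /subspace_continuousP/(_ (x, x))] := hKs p q rs.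
move=> /(_ (conj Xx Xx)) /cvgrPdist_le /(_ e e0).
rewrite /within /= => -[[A B] /= [Ax Bx] AB].
exists (A `&` B); first exact: filterI.
move=> a b [[Aa _] Xa] [[_ Bb] Xb]; rewrite distrC.
exact: (AB (a, b)).
Qed.

Lemma gram_section q x : X x -> forall e, 0 < e -> exists2 N, nbhs x N &
  forall a b, (N `&` X) a -> (N `&` X) b -> `|ip (E q a) (E q b) - K x x q q| <= e.
Proof.
move=> Xx e e0; have m0 : mdeg ([ffun=> 0%N] : multiindex d) = 0%N.
  by rewrite /mdeg big1// => i _; rewrite ffunE.
have [|N Nx NP] := @Css_near [ffun=> 0%N] q q x e _ Xx e0; first by rewrite m0.
exists N => // a b Na Nb; have := NP a b Na Nb.
by rewrite /pderiv2X m0 /= ip_sections//; [case: Na|case: Nb].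
Qed.

(** The sections at interior points suffice: the Gram matrix makes [y |-> E q y] continuous on [X],
    and every point of [X] is a limit of interior ones. *)
Lemma section_total f :
  (forall g, [set E p.1 p.2 | p in [set p : 'I_Q * 'rV[R]_d | X° p.2]] g ->
    ip f g = 0) -> f = 0.
Proof.
move=> fG; have f0 y q : X° y -> ip f (E q y) = 0.
  by move=> Xy; apply: fG; exists (q, y).
apply: (rkhs_ev_inj hF) => x Xx; apply/colP => q.
rewrite -!ip_section// (ip0l ip_linear).
have PF : ProperFilter (within X° (nbhs x)) by apply: within_nbhs_proper; exact: hX.
have EE : E q y @[y --> within X° (nbhs x)] --> E q x.
  apply/cvgrPdist_le => e e0.
  have [N Nx NP] := gram_close ipC ip_linear ip_norm (gram_section q Xx) e0.
  have Nx0 := nbhs_singleton Nx; apply: filterS Nx => y Ny Xy; apply: NP; split=> //.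
  exact: interior_subset.
have h1 : ip (E q y) f @[y --> within X° (nbhs x)] --> ip (E q x) f.
  by apply: (cvg_ipl ipC ip_linear ip_norm); exact: EE.
have h2 : ip (E q y) f @[y --> within X° (nbhs x)] --> 0.
  apply/cvgrPdist_le => e e0; apply: filterS (@filterT _ (nbhs x) _) => y _ Xy.
  by rewrite ipC f0// subr0 normr0 ltW.
by rewrite ipC; exact: (cvg_unique (@Rhausdorff R) h1 h2).
Qed.

Local Notation G := [set E p.1 p.2 | p in [set p : 'I_Q * 'rV[R]_d | X° p.2]].

Lemma regular_mword q r : (mdeg r <= s)%N -> regular ip (E q) X° G (mword r).
Proof.
move=> rs.
have oX : open X° by exact: open_interior.
have sX : X° `<=` X by exact: interior_subset.
have kE p x b : X° x -> X° b -> ip (E p x) (E q b) = K x b p q.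
  by move=> /sX Xx /sX Xb; rewrite ip_sections.
have [[K1 K2] _] := hKs q q rs.
have kd b p : X° b -> X° p ->
    wderiv (mword r) (fun b => ip (E q p) (E q b)) b = pderiv r (fun y => K p y q q) b.
  by move=> Xb Xp; apply: (eq_in_wderiv _ oX _ Xb) => y Xy; rewrite kE.
split.
- move=> _ [[p x] /= Xx <-]; have [[h _] _] := hKs p q rs.
  by apply: eq_in_wderivable oX _ (h x Xx) => y Xy; rewrite kE.
- by move=> p Xp; apply: eq_in_wderivable oX _ (K1 p Xp) => y Xy; rewrite kE.
- by move=> b Xb; apply: eq_in_wderivable oX _ (K2 b Xb) => y Xy; rewrite kd.
(* Continuity at [(y, y)] with tolerance 1 gives the local bound [|c| + 1]. *)
move=> y Xy; have [N Ny NP] := Css_near q q rs (sX _ Xy) (@ltr01 R).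
have : nbhs y (N `&` X°) by apply: filterI => //; exact: open_nbhs_nbhs.
move=> /nbhs_ballP[rho rho0 sub].
set c := pderiv2X _ _ _ (y, y) in NP.
exists (`|c| + 1), rho; split=> //; first by move=> z /sub[].
move=> p b /sub[Np Xp] /sub[Nb Xb].
have -> : wderiv (mword r) (fun p => wderiv (mword r) (fun b => ip (E q p) (E q b)) b) p =
   pderiv2X X r (fun x y => K x y q q) (p, b).
  rewrite pderiv2X_interior//; apply: (eq_in_wderiv _ oX _ Xp) => z Xz.
  exact: kd.
have := NP p b (conj Np (sX _ Xp)) (conj Nb (sX _ Xb)).
move=> h; rewrite -[X in `|X|](subrK c) (le_trans (ler_normD _ _))// addrC lerD2l.
exact: h.
Qed.

Lemma pderivX_representer q r x : (mdeg r <= s)%N -> X x ->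
  exists k, forall f, pderivX X r (fun y => ev f y q 0) x = ip f k.
Proof.
move=> rs Xx; have oX : open X° by exact: open_interior.
have sX : X° `<=` X by exact: interior_subset.
have [mr|mr] := eqVneq (mdeg r) 0%N.
  by exists (E q x) => f; rewrite /pderivX mr eqxx ip_section.
have [|kap kapP] := derivative_representer ipC ip_linear ip_norm oX section_total
    (E := E q) (w := mword r).
  move=> w1 w2 /mword_suffix[r' [<- r'r]].
  by apply: regular_mword; exact: leq_trans rs.
have evE f b : X° b -> pderiv r (fun y => ev f y q 0) b = ip f (kap b).
  move=> Xb; have [_ <-//] := kapP f.
  by apply: (eq_in_wderiv _ oX _ Xb) => y Xy; rewrite ip_section//; exact: sX.
have [Xix|Xix] := boolP (x \in (X° : set 'rV[R]_d)).
  exists (kap x) => f; rewrite /pderivX (negPf mr) /extend_lim Xix evE//.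
  by rewrite inE in Xix.
have PF : ProperFilter (within X° (nbhs x)) by apply: within_nbhs_proper; exact: hX.
(* Since [kap b] differentiates at [b] and [kap a] at [a], their inner product is the kernel
   differentiated in both arguments. [Css] makes this continuous up to [(x, x)], even for [x] on the
   boundary. *)
have gramE a b : X° a -> X° b ->
    ip (kap a) (kap b) = pderiv2X X r (fun x y => K x y q q) (b, a).
  move=> Xa Xb; have [_ <-//] := kapP (kap a).
  rewrite pderiv2X_interior//; apply: (eq_in_wderiv _ oX _ Xb) => y Xy.
  rewrite ipC; have [_ <-//] := kapP (E q y).
  by apply: (eq_in_wderiv _ oX _ Xa) => z Xz; rewrite ip_sections//; exact: sX.
have [|l kl] := gram_cvg ipC ip_linear ip_norm (kap := kap) (Y := X°) (x := x)
    (c := pderiv2X X r (fun x y => K x y q q) (x, x)) _ PF.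
  move=> e e0; have [N Nx NP] := Css_near q q rs Xx e0; exists N => // a b [Na Xa] [Nb Xb].
  by rewrite gramE//; apply: NP; split=> //; exact: sX.
exists l => f; rewrite /pderivX (negPf mr) /extend_lim (negPf Xix).
rewrite (@eq_in_lim_within _ _ X° _ (fun b => ip (kap b) f)); last first.
  by move=> y Xy; rewrite ipC evE.
rewrite (ipC f); apply: (cvg_lim (@Rhausdorff R)).
exact: (cvg_ipl ipC ip_linear ip_norm).
Qed.

Lemma diff_app_representer (D : diffop R d Q) x : in_O s D -> X x ->
  exists k, forall f, diff_app X D (ev f) x = ip f k.
Proof.
move=> Ds Xx.
have /choice[kap kapP] : forall qr : 'I_Q * multiindex d, exists k, (mdeg qr.2 <= s)%N ->
    forall f, pderivX X qr.2 (fun y => ev f y qr.1 0) x = ip f k.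
  move=> [q r]; have [rs|rs] := leqP (mdeg r) s; last by exists 0.
  by have [k kP] := pderivX_representer q rs Xx; exists k.
exists (\sum_q (D q).1 *: \sum_(cr <- (D q).2) cr.1 *: kap (q, cr.2)) => f.
rewrite (ip_sumr ipC ip_linear); apply: eq_bigr => q _.
rewrite (ipZr ipC ip_linear) (ip_sumr ipC ip_linear); congr (_ * _).
rewrite /diff_app1 big_seq [RHS]big_seq; apply: eq_bigr => cr crD.
by rewrite (ipZr ipC ip_linear) -kapP//; exact: (allP (Ds q)).
Qed.

Lemma reproducing_diff_app (D : diffop R d Q) x f : in_O s D -> X x ->
  diff_app X D (ev f) x = ip f (DKelt X K ev D x).
Proof.
move=> Ds Xx; have [k kP] := diff_app_representer Ds Xx.
suff -> : DKelt X K ev D x = k by exact: kP.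
(* Testing [k] against the section at [x'] applies [D] to that section, which gives the components
   of DK(x', x). So [k] is the function that [as_elt] looks for, and evaluations determine it
   uniquely. *)
have kE x' : X x' -> ev k x' = DK X K D x' x.
  move=> Xx'; apply/colP => p; rewrite -ip_section// ipC -kP /DK summxE.
  apply: eq_bigr => q _; rewrite mxE; congr (_ * _); rewrite -colE !mxE.
  apply: eq_bigr => cr _; congr (_ * _); apply: eq_in_pderivX => // y Xy.
  by rewrite -ip_section// ip_sections.
rewrite /DKelt /as_elt; case: xgetP => [g _ gP|nk]; last by case: (nk k).
by apply: (rkhs_ev_inj hF) => y Xy; rewrite gP// kE.
Qed.

End Reproducing.

(** * Constraints *)

Lemma cvg_big_sum (R : realType) T (U : set_system T) {FU : Filter U} (I : Type)
    (r : seq I) (f : I -> T -> R) (l : I -> R) :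
  (forall i, f i t @[t --> U] --> l i) ->
  \sum_(i <- r) f i t @[t --> U] --> \sum_(i <- r) l i.
Proof.
move=> fl; elim: r => [|i r IH].
  by rewrite big_nil; under eq_fun do rewrite big_nil; exact: cvg_cst.
by rewrite big_cons; under eq_fun do rewrite big_cons; exact: cvgD.
Qed.

Section Quadratic_forms.
Context {R : realType} {n : nat}.
Implicit Types (u : 'cV[R]_n) (A : 'M[R]_n).

Lemma cvdot_mulmx u A :
  cvdot u (A *m u) = \sum_i \sum_j u i 0 * u j 0 * A i j.
Proof.
rewrite /cvdot mxE; apply: eq_bigr => i _; rewrite !mxE mulr_sumr.
by apply: eq_bigr => j _; ring.
Qed.

Lemma cvdotE u : cvdot u u = \sum_i u i 0 ^+ 2.
Proof. by rewrite /cvdot mxE; apply: eq_bigr => i _; rewrite mxE expr2. Qed.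

Lemma cvdot_ge0 u : 0 <= cvdot u u.
Proof. by rewrite cvdotE sumr_ge0// => i _; rewrite sqr_ge0. Qed.

Lemma cvdot_eq0 u : cvdot u u = 0 -> u = 0.
Proof.
rewrite cvdotE => /eqP; rewrite psumr_eq0 => [|i _]; last exact: sqr_ge0.
move=> /allP h; apply/colP => i; rewrite mxE; apply/eqP.
by have := h i; rewrite mem_index_enum sqrf_eq0 => /(_ isT).
Qed.

Lemma cvdotZ a u A : cvdot (a *: u) (A *m (a *: u)) = a ^+ 2 * cvdot u (A *m u).
Proof.
rewrite !cvdot_mulmx mulr_sumr; apply: eq_bigr => i _; rewrite mulr_sumr.
by apply: eq_bigr => j _; rewrite !mxE; ring.
Qed.

Lemma loewner_scalarP (t : R) A : A^T = A ->
  loewner t%:M A <-> forall u, t * cvdot u u <= cvdot u (A *m u).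
Proof.
move=> As; have E u : cvdot u ((A - t%:M) *m u) = cvdot u (A *m u) - t * cvdot u u.
  rewrite /cvdot mulmxBl mul_scalar_mx mulmxBr -scalemxAr.
  by move: (u^T *m (A *m u)) (u^T *m u) => M N; rewrite !mxE.
split=> [[_ h] u|h]; first by have := h u; rewrite E subr_ge0.
by split=> [|u]; [rewrite linearB/= As tr_scalar_mx|rewrite E subr_ge0].
Qed.

Lemma loewner0P A : A^T = A ->
  loewner 0 A <-> forall u, 0 <= cvdot u (A *m u).
Proof.
move=> As; have := loewner_scalarP 0 As; rewrite raddf0 => ->.
by split=> h u; have := h u; rewrite mul0r.
Qed.

End Quadratic_forms.

(** * Original and second-order cone constraints *)

Section Constraints.
Context {R : realType} {d Q B s : nat} (X : set 'rV[R]_d).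
Hypothesis hX : X `<=` closure X°.
Context (K : 'rV[R]_d -> 'rV[R]_d -> 'M[R]_Q).
Hypotheses (hK : matrix_kernel X K) (hKs : Css X s K).
Context (F : completeNormedModType R) (ip : {dot F for idfun}).
Context (ev : F -> 'rV[R]_d -> 'cV[R]_Q).
Hypothesis hF : is_rkhs X K ip ev.

Let ipC := dot_sym ip.
Let ip_linear := dot_linear ip.
Let ip_norm := rkhs_normE hF.

Context (c : constraint d Q B F).
Hypothesis hD : forall p1 p2 : 'I_(cP c), in_O s (cD p1 p2).
Hypothesis hsym : forall (f : F) x, X x -> (diff_mx X ev c f x)^T = diff_mx X ev c f x.

(** Represents the quadratic form of D(f)(x) at [u], so that a matrix constraint becomes a family,
    indexed by [u], of scalar constraints affine in the pair. *)
Definition quad_elt (u : 'cV[R]_(cP c)) x : F :=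
  \sum_p1 \sum_p2 (u p1 0 * u p2 0) *: DKelt X K ev (cD p1 p2) x.

Definition quad_affine (u : 'cV[R]_(cP c)) (b : 'cV[R]_B) : R :=
  \sum_p u p 0 ^+ 2 * ((cGamma c *m b) p 0 - cb0 c p 0).

Lemma cons_mx_sym z x : X x -> (cons_mx X ev c z x)^T = cons_mx X ev c z x.
Proof. by move=> Xx; rewrite /cons_mx linearD /= hsym// tr_diag_mx. Qed.

Lemma cons_mx_quad z x u : X x -> cvdot u (cons_mx X ev c z x *m u) =
  ip (z.1 - cf0 c) (quad_elt u x) + quad_affine u z.2.
Proof.
move=> Xx; rewrite cvdot_mulmx (ip_sumr ipC ip_linear) -big_split /=.
apply: eq_bigr => i _; rewrite (ip_sumr ipC ip_linear).
have -> : u i 0 ^+ 2 * ((cGamma c *m z.2) i 0 - cb0 c i 0) =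
   \sum_j u i 0 * u j 0 * (diag_mx (cGamma c *m z.2 - cb0 c)^T i j).
  rewrite (bigD1 i)//= big1 => [|j ji]; last first.
    by rewrite [diag_mx _ _ _]mxE eq_sym (negPf ji) mulr0n mulr0.
  by rewrite addr0 expr2 !mxE eqxx mulr1n.
rewrite -big_split /=; apply: eq_bigr => j _.
rewrite (ipZr ipC ip_linear) -(reproducing_diff_app hX hK hKs hF _ (hD i j) Xx).
by rewrite /cons_mx mxE [diff_mx _ _ _ _ _ i j]mxE mulrDr.
Qed.

Lemma loewner0_cons_mx z x : X x -> loewner 0 (cons_mx X ev c z x) <->
  forall u, 0 <= ip (z.1 - cf0 c) (quad_elt u x) + quad_affine u z.2.
Proof.
move=> Xx; rewrite loewner0P; last exact: cons_mx_sym.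
by split=> h u; have := h u; rewrite cons_mx_quad.
Qed.

Lemma loewner_scalar_cons_mx t z x : X x -> loewner t%:M (cons_mx X ev c z x) <->
  forall u, t * cvdot u u <= ip (z.1 - cf0 c) (quad_elt u x) + quad_affine u z.2.
Proof.
move=> Xx; rewrite loewner_scalarP; last exact: cons_mx_sym.
by split=> h u; have := h u; rewrite cons_mx_quad.
Qed.

Lemma cvg_quad T (U : set_system T) {FU : Filter U} (z : T -> F * 'cV[R]_B) (l : F * 'cV[R]_B) u x :
  weakly_to ip U (fst \o z) l.1 -> (forall p, (z t).2 p 0 @[t --> U] --> l.2 p 0) ->
  ip ((z t).1 - cf0 c) (quad_elt u x) + quad_affine u (z t).2 @[t --> U] -->
  ip (l.1 - cf0 c) (quad_elt u x) + quad_affine u l.2.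
Proof.
move=> z1 z2; apply: cvgD.
  rewrite (ipBl ip_linear); under eq_fun do rewrite (ipBl ip_linear).
  by apply: cvgB; [exact: z1|exact: cvg_cst].
apply: cvg_big_sum => p; apply: cvgMr; apply: cvgB; last exact: cvg_cst.
rewrite mxE; under eq_fun do rewrite mxE.
by apply: cvg_big_sum => q; apply: cvgMr; exact: z2.
Qed.

Lemma original_weakly_closed T (U : set_system T) {FU : ProperFilter U}
    (z : T -> F * 'cV[R]_B) (l : F * 'cV[R]_B) x : X x ->
  weakly_to ip U (fst \o z) l.1 -> (forall p, (z t).2 p 0 @[t --> U] --> l.2 p 0) ->
  (\forall t \near U, loewner 0 (cons_mx X ev c (z t) x)) ->
  loewner 0 (cons_mx X ev c l x).
Proof.
move=> Xx z1 z2 hz; apply/(loewner0_cons_mx _ Xx) => u.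
have zc : ip ((z t).1 - cf0 c) (quad_elt u x) + quad_affine u (z t).2 @[t --> U] -->
    ip (l.1 - cf0 c) (quad_elt u x) + quad_affine u l.2 by exact: cvg_quad.
apply: (cvgr_to_ge zc); apply: filterS hz => t.
by move=> /(loewner0_cons_mx _ Xx).
Qed.

Context (normX : 'rV[R]_d -> R).
Hypothesis hnormX : is_norm normX.
Hypothesis hP : (0 < cP c)%N.

(** The center itself, with any unit vector, contributes 0 to the supremum; [hP] ensures that a unit
    vector exists. *)
Lemma eta_ge0 x0 delta : X x0 -> 0 < delta ->
  (0 <= Defs.eta X normX K ev c x0 delta)%E.
Proof.
move=> Xx0 d0; apply: ereal_sup_ubound; exists x0, (delta_mx (Ordinal hP) 0).
have n0 : normX 0 = 0.
  by case: hnormX => _ nZ _; have := nZ 0 0; rewrite scale0r normr0 mul0r.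
split.
- by split=> //; rewrite subrr n0 ltW.
- rewrite /sphere /= cvdotE (bigD1 (Ordinal hP))//= mxE !eqxx expr1n big1 ?addr0//.
  by move=> i ip0; rewrite mxE (negPf ip0) expr0n.
rewrite big1 ?normr0// => i _; rewrite big1// => j _.
by rewrite subrr scaler0.
Qed.

Lemma quad_elt_eta x0 delta x u : ballX X normX x0 delta x -> sphere u ->
  (`|quad_elt u x0 - quad_elt u x|%:E <= Defs.eta X normX K ev c x0 delta)%E.
Proof.
move=> xb su; apply: ereal_sup_ubound; exists x, u; split=> //; congr (`| _ |%:E).
rewrite -sumrB; apply: eq_bigr => i _; rewrite -sumrB; apply: eq_bigr => j _.
by rewrite scalerBr.
Qed.

(** Moving from the center of a covering ball to [x] changes the form at a unit vector by at most
    [eta] times the norm of [h], by Cauchy-Schwarz; this is exactly the margin imposed at the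
    center. *)
Lemma soc_set_original (bc : ball_cover R d) (A : set 'rV[R]_d) z x :
  is_ball_cover X normX A bc -> A x -> X x -> soc_set X normX K ev c bc z ->
  loewner 0 (cons_mx X ev c z x).
Proof.
move=> [Xm dm cov] Ax Xx soc; apply/(loewner0_cons_mx _ Xx) => u.
have [m _ xm] := cov _ Ax.
have := soc m; set h := z.1 - cf0 c.
case tE : (_ * _)%E => [t| |] //.
move=> /(loewner_scalar_cons_mx _ _ (Xm m)); rewrite -/h => tq.
have [->|u0] := eqVneq u 0.
  rewrite /quad_elt big1 => [|i _]; last by rewrite big1// => j _; rewrite mxE mul0r scale0r.
  rewrite (ip0r ipC ip_linear) add0r /quad_affine big1// => i _.
  by rewrite mxE expr0n mul0r.
have uu : 0 < cvdot u u.
  by rewrite lt_def cvdot_ge0 andbT; apply: contra_neq u0; exact: cvdot_eq0.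
(* [eta] controls unit vectors only, and the constraint is homogeneous of degree two in [u]. *)
pose a := Num.sqrt (cvdot u u); pose v := a^-1 *: u.
have a2 : a ^+ 2 = cvdot u u by rewrite sqr_sqrtr ?ltW.
have a0 : a != 0 by rewrite -sqrf_eq0 a2 lt0r_neq0.
have sv : sphere v.
  rewrite /sphere /= cvdotE; under eq_bigr do rewrite mxE exprMn.
  by rewrite -mulr_sumr -cvdotE -a2 exprVn mulVf// expf_neq0.
have uv : u = a *: v by rewrite /v scalerA divff// scale1r.
have -> : ip h (quad_elt u x) + quad_affine u z.2 =
    a ^+ 2 * (ip h (quad_elt v x) + quad_affine v z.2).
  by rewrite -!(cons_mx_quad z)// -cvdotZ -uv.
rewrite mulr_ge0 ?sqr_ge0//.
have := tq v; rewrite (_ : cvdot v v = 1)// mulr1 => tv.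
have nh : `|h| * `|quad_elt v (bcenter m) - quad_elt v x| <= t.
  rewrite -lee_fin -tE EFinM muleC; apply: lee_wpmul2r; first by rewrite lee_fin.
  exact: quad_elt_eta.
have := cauchy_schwarz ipC ip_linear ip_norm h (quad_elt v (bcenter m) - quad_elt v x).
rewrite (ipBr ipC ip_linear); lra.
Qed.

Lemma soc_weakly_closed (bc : ball_cover R d) (A : set 'rV[R]_d)
    T (U : set_system T) {FU : ProperFilter U} (z : T -> F * 'cV[R]_B) (l : F * 'cV[R]_B) :
  is_ball_cover X normX A bc ->
  weakly_to ip U (fst \o z) l.1 -> (forall p, (z t).2 p 0 @[t --> U] --> l.2 p 0) ->
  (\forall t \near U, soc_set X normX K ev c bc (z t)) -> soc_set X normX K ev c bc l.
Proof.
move=> [Xm dm cov] z1 z2 hz m.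
have := eta_ge0 (Xm m) (dm m).
set e := Defs.eta _ _ _ _ _ _ _; case eE : e => [r| |] //; last first.
  move=> _.
  (* For infinite [eta] the constraint forces the first component to be [cf0 c], an equality that
     weak limits preserve. *)
  have z0 : \forall t \near U, (z t).1 = cf0 c /\ loewner 0 (cons_mx X ev c (z t) (bcenter m)).
    apply: filterS hz => t /(_ m); rewrite -/e eE.
    have [h0|h0] := eqVneq ((z t).1 - cf0 c) 0.
      by rewrite h0 normr0 mule0 /= raddf0 => ?; split=> //; apply/eqP; rewrite -subr_eq0 h0.
    by rewrite gt0_mulye// lte_fin normr_gt0.
  have l0 : l.1 = cf0 c.
    apply: (ip_ext ip_linear ip_norm) => g.
    have h1 : ip (z t).1 g @[t --> U] --> ip (cf0 c) g.
      apply/cvgrPdist_le => eps eps0; apply: filterS z0 => t [-> _].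
      by rewrite subrr normr0 ltW.
    exact: (cvg_unique (@Rhausdorff R) (z1 g) h1).
  rewrite l0 subrr normr0 mule0 /= raddf0.
  by apply: (original_weakly_closed (Xm m) z1 z2); apply: filterS z0 => t [].
rewrite lee_fin -EFinM => r0.
have key t : soc_set X normX K ev c bc (z t) -> forall u,
   r * `|(z t).1 - cf0 c| * cvdot u u <=
   ip ((z t).1 - cf0 c) (quad_elt u (bcenter m)) + quad_affine u (z t).2.
  by move=> /(_ m); rewrite -/e eE -EFinM => /(loewner_scalar_cons_mx _ _ (Xm m)).
apply/(loewner_scalar_cons_mx _ _ (Xm m)) => u.
have zc : ip ((z t).1 - cf0 c) (quad_elt u (bcenter m)) + quad_affine u (z t).2
    @[t --> U] --> ip (l.1 - cf0 c) (quad_elt u (bcenter m)) + quad_affine u l.2.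
  exact: cvg_quad.
rewrite mulrAC.
(* Lower semicontinuity of the norm is applied after division by [r * cvdot u u]. If one factor
   vanishes, the norm drops out and the affine part alone passes to the limit. *)
have := cvdot_ge0 u; rewrite le_eqVlt => /predU1P[u0|u0]; last first.
  have [r00|r00] := eqVneq r 0; last first.
    have ru : 0 < r * cvdot u u by rewrite mulr_gt0// lt_def r00.
    rewrite mulrC -ler_pdivlMr//.
    apply: (weakly_to_le_norm ipC ip_linear ip_norm (U := U)
      (h := fun t => (z t).1 - cf0 c)
      (r := fun t => (ip ((z t).1 - cf0 c) (quad_elt u (bcenter m)) + quad_affine u (z t).2) / (r * cvdot u u))).
    - move=> g; rewrite (ipBl ip_linear); under eq_fun do rewrite (ipBl ip_linear).
      by apply: cvgB; [exact: z1|exact: cvg_cst].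
    - apply: filterS hz => t /key/(_ u) ht.
      by rewrite ler_pdivlMr// mulrA (mulrC _ r).
    - exact: cvgMl.
  rewrite r00 !mul0r; apply: (cvgr_to_ge zc); apply: filterS hz => t /key/(_ u).
  by rewrite r00 !mul0r.
rewrite -u0 mulr0 mul0r; apply: (cvgr_to_ge zc); apply: filterS hz => t /key/(_ u).
by rewrite -u0 mulr0.
Qed.

End Constraints.

(** * Certificates *)

Section Cell_certificates.
Context {R : realType} {F : completeNormedModType R} (ip : {dot F for idfun}).
Hypothesis ip_norm : forall f, ip f f = `|f| ^+ 2.
Context (w : cell F).

Let ipC := dot_sym ip.
Let ip_linear := dot_linear ip.

(** The conditions of [omega_set] without the span requirement, which [certifies_in_span] restores;
    [beta] stands for the part depending on [b]. *)
Definition certifies (h : F) (beta : R) (g : 'I_(oJB w) -> F) (xi : 'I_(oJH w) -> R) :=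
  [/\ forall j, 0 <= xi j,
      0 <= beta + \sum_j ip (g j) (oc j) - \sum_j xi j * orho j - \sum_j orad j * `|g j| &
      - h + \sum_j g j - \sum_j xi j *: ov j = 0].

Lemma certifies_ip h beta g xi f : certifies h beta g xi ->
  ip h f = \sum_j ip (g j) f - \sum_j xi j * ip (ov j) f.
Proof.
move=> [_ _ e]; have -> : h = \sum_j g j - \sum_j xi j *: ov j.
  by apply/eqP; rewrite -subr_eq0 -oppr_eq0 opprB addrC addrA e.
rewrite (ipBl ip_linear) !(ip_suml ip_linear); congr (_ - _).
by apply: eq_bigr => j _; rewrite (ipZl ip_linear).
Qed.

(** Weak duality with the slacks kept, by Cauchy-Schwarz on each [g j]. For [f] in the cell the left
    side is nonnegative, which gives the original constraint; the positive slacks also bound every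
    multiplier by the right side. *)
Lemma certifies_slack h beta g xi f : certifies h beta g xi ->
  \sum_j (orad j - `|f - oc j|) * `|g j| + \sum_j (orho j - ip (ov j) f) * xi j
    <= beta + ip h f.
Proof.
move=> cert; rewrite (certifies_ip f cert); case: cert => _ h0 _.
have h1 : \sum_j (orad j - `|f - oc j|) * `|g j| <=
    \sum_j ip (g j) f - \sum_j ip (g j) (oc j) + \sum_j orad j * `|g j|.
  rewrite -sumrB -big_split /=; apply: ler_sum => j _.
  have := normr_ip ipC ip_linear ip_norm (g j) (f - oc j).
  by rewrite (ipBr ipC ip_linear) ler_norml => /andP[+ _]; lra.
have h2 : \sum_j (orho j - ip (ov j) f) * xi j =
    \sum_j xi j * orho j - \sum_j xi j * ip (ov j) f.
  by rewrite -sumrB; apply: eq_bigr => j _; ring.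
by rewrite h2; lra.
Qed.

Lemma certifies_cell h beta g xi f : certifies h beta g xi ->
  closure (cell_set ip w) f -> 0 <= beta + ip h f.
Proof.
move=> cert; rewrite closureEcvg => -[G GF [Gf Gw]].
have Gf' : y @[y --> G] --> f by [].
have h1 : ip y h @[y --> G] --> ip f h by apply: (cvg_ipl ipC ip_linear ip_norm); exact: Gf'.
have h2 : (beta + ip y h) @[y --> G] --> beta + ip f h by apply: cvgD => //; exact: cvg_cst.
rewrite (ipC h); apply: (cvgr_to_ge h2).
apply: filterS (Gw _ (fun x Sx => Sx)) => y [yc yv].
rewrite ipC; apply: le_trans (certifies_slack y cert).
case: cert => xi0 _ _; rewrite addr_ge0// sumr_ge0// => j _; rewrite mulr_ge0//.
  by rewrite subr_ge0 ltW.
by rewrite subr_ge0 ltW.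
Qed.

Lemma cell_span_subspace h : lin_subspace (cell_span h w).
Proof.
split.
  exists 0, (fun=> 0), (fun=> 0).
  by rewrite scale0r !big1 ?addr0// => i _; rewrite scale0r.
move=> a f g [a1 [al1 [be1 ->]]] [a2 [al2 [be2 ->]]].
exists (a * a1 + a2), (fun l => a * al1 l + al2 l), (fun l => a * be1 l + be2 l).
rewrite !scalerDr !scaler_sumr scalerDl -!scalerA.
under [in RHS]eq_bigr do rewrite scalerDl -scalerA.
rewrite big_split /= -!addrA; congr (_ + _).
under [X in _ = _ + (_ + (_ + X))]eq_bigr do rewrite scalerDl -scalerA.
rewrite big_split /= [RHS]addrCA; congr (_ + _).
by rewrite addrCA; congr (_ + _); rewrite addrCA.
Qed.

Lemma cell_span_self h : cell_span h w h.
Proof.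
exists 1, (fun=> 0), (fun=> 0).
by rewrite scale1r !big1 ?addr0// => i _; rewrite scale0r.
Qed.

Lemma cell_span_center h (j : 'I_(oJB w)) : cell_span h w (oc j).
Proof.
exists 0, (fun l => (l == j)%:R), (fun=> 0).
rewrite scale0r add0r (bigD1 j)//= eqxx scale1r !big1 ?addr0// => i.
  by rewrite scale0r.
by move=> /negPf ->; rewrite scale0r.
Qed.

Lemma cell_span_normal h (j : 'I_(oJH w)) : cell_span h w (ov j).
Proof.
exists 0, (fun=> 0), (fun l => (l == j)%:R).
rewrite scale0r add0r big1 ?add0r => [|i _]; last by rewrite scale0r.
rewrite (bigD1 j)//= eqxx scale1r big1 ?addr0// => i.
by move=> /negPf ->; rewrite scale0r.
Qed.

(* Projecting the multipliers onto the span changes neither the inner products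
   with the centers nor the linear identity, and does not increase the norms. *)
Lemma certifies_in_span h beta g xi : (forall j : 'I_(oJB w), 0 < orad j) ->
  certifies h beta g xi ->
  exists2 p : 'I_(oJB w) -> F, (forall j, cell_span h w (p j)) & certifies h beta p xi.
Proof.
move=> r0 cert; have [xi0 h0 eq0] := cert.
pose gens := h :: [seq oc j | j : 'I_(oJB w)] ++ [seq ov j | j : 'I_(oJH w)].
have gens_h : h \in gens by rewrite mem_head.
have gens_c (j : 'I_(oJB w)) : oc j \in gens by rewrite inE mem_cat; apply/orP; right; apply/orP; left; apply/fintype.imageP; exists j.
have gens_v (j : 'I_(oJH w)) : ov j \in gens by rewrite inE mem_cat; apply/orP; right; apply/orP; right; apply/fintype.imageP; exists j.
have gensS v : v \in gens -> cell_span h w v.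
  rewrite inE mem_cat => /predU1P[->|/orP[/fintype.imageP[j _ ->]|/fintype.imageP[j _ ->]]].
  - exact: cell_span_self.
  - exact: cell_span_center.
  - exact: cell_span_normal.
have /choice[p pP] := fun j =>
  proj_seq ipC ip_linear ip_norm (cell_span_subspace h) gensS (g j).
exists p; first by move=> j; have [] := pP j.
have np j : `|p j| <= `|g j|.
  have [_ gp ort] := pP j; have := ort _ gp.
  rewrite (ipBl ip_linear) => /eqP; rewrite subr_eq0 => /eqP gpp.
  have [->|pj0] := eqVneq (p j) 0; first by rewrite normr0.
  have := cauchy_schwarz ipC ip_linear ip_norm (g j) (p j).
  by rewrite gpp ip_norm expr2 ler_pM2r// normr_gt0.
have pv j v : v \in gens -> ip (p j) v = ip (g j) v.
  by move=> vg; have [_ /(_ v vg) + _] := pP j; rewrite (ipBl ip_linear); lra.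
split=> //.
  apply: (le_trans h0).
  have -> : \sum_j ip (p j) (oc j) = \sum_j ip (g j) (oc j).
    by apply: eq_bigr => j _; rewrite pv.
  by rewrite lerD2l lerN2; apply: ler_sum => j _; rewrite ler_wpM2l// ltW.
set x := LHS.
(* The residual [x] of the projected multipliers has the same products with the generators as the
   original residual, which is zero. Being built from elements in their span, it is then orthogonal
   to itself. *)
have xg v : v \in gens -> ip x v = 0.
  move=> vg; rewrite -(ip0l ip_linear v) -eq0 /x.
  rewrite !(ipDl ip_linear) !(ip_suml ip_linear); congr (_ + _ + _).
  by apply: eq_bigr => j _; rewrite pv.
have xp j : ip x (p j) = 0 by have [_ _ ort] := pP j; exact: ort.
apply/eqP; rewrite -normr_eq0 -sqrf_eq0 -ip_norm {2}/x.
rewrite (ipBr ipC ip_linear) (ipDr ipC ip_linear) (ipNr ipC ip_linear) xg//.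
rewrite !(ip_sumr ipC ip_linear) !big1 ?oppr0 ?addr0// => j _.
by rewrite (ipZr ipC ip_linear) xg ?mulr0.
Qed.

(* A point of the cell bounds the multipliers of weakly convergent certificates. *)
Lemma certifies_weakly_closed T (U : set_system T) (UU : UltraFilter U)
    (h : T -> F) (beta : T -> R) h' beta' :
  cell_set ip w !=set0 ->
  weakly_to ip U h h' -> beta t @[t --> U] --> beta' ->
  (\forall t \near U, exists g xi, certifies (h t) (beta t) g xi) ->
  exists g xi, certifies h' beta' g xi.
Proof.
move=> [f [fc fv]] hh' bb' ex.
have /choice[gx gxP] : forall t, exists gx : ('I_(oJB w) -> F) * ('I_(oJH w) -> R),
    (exists g xi, certifies (h t) (beta t) g xi) -> certifies (h t) (beta t) gx.1 gx.2.
  move=> t; have [[g [xi cert]]|n] := pselect (exists g xi, certifies (h t) (beta t) g xi).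
    by exists (g, xi).
  by exists (fun=> 0, fun=> 0).
have cert : \forall t \near U, certifies (h t) (beta t) (gx t).1 (gx t).2.
  by apply: filterS ex => t; exact: gxP.
have [M hM] : exists M, \forall t \near U, beta t + ip (h t) f <= M.
  have lim : (beta t + ip (h t) f) @[t --> U] --> beta' + ip h' f.
    by apply: cvgD => //; exact: hh'.
  exists (beta' + ip h' f + 1); apply: (cvgr_le _ lim); lra.
have slack : \forall t \near U,
    (forall j, (orad j - `|f - oc j|) * `|(gx t).1 j| <= M) /\
    (forall j, (orho j - ip (ov j) f) * (gx t).2 j <= M).
  apply: filterS2 cert hM => t ct /(le_trans (certifies_slack f ct)).
  have [xi0 _ _] := ct.
  have p1 j : 0 <= (orad j - `|f - oc j|) * `|(gx t).1 j|.
    by rewrite mulr_ge0// subr_ge0 ltW.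
  have p2 j : 0 <= (orho j - ip (ov j) f) * (gx t).2 j.
    by rewrite mulr_ge0// subr_ge0 ltW.
  move=> le; split=> j; apply: le_trans le.
    by rewrite (bigD1 j)//= -addrA lerDl addr_ge0// sumr_ge0.
  by rewrite (bigD1 j)//= addrCA lerDl addr_ge0// sumr_ge0.
have gb j : \forall t \near U, `|(gx t).1 j| <= M / (orad j - `|f - oc j|).
  by apply: filterS slack => t [/(_ j) + _]; rewrite ler_pdivlMr ?subr_gt0// mulrC.
have xb j : \forall t \near U, `|(gx t).2 j| <= M / (orho j - ip (ov j) f).
  apply: filterS2 cert slack => t [xi0 _ _] [_ /(_ j)].
  by rewrite ger0_norm// ler_pdivlMr ?subr_gt0// mulrC.
have /choice[g gP] := fun j => ultra_weakly_to ipC ip_linear ip_norm UU (gb j).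
have /choice[xi xiP] := fun j => ultra_cvg_bounded UU (xb j).
(* The norms converge too, but possibly to more than the norms of the weak limits. They enter with a
   negative sign, so replacing [N j] by the smaller norm keeps the inequality. *)
have /choice[N NP] : forall j, exists N : R, `|(gx t).1 j| @[t --> U] --> N.
  move=> j; apply: (ultra_cvg_bounded UU (M := M / (orad j - `|f - oc j|))).
  by apply: filterS (gb j) => t; rewrite normr_id.
have UP : ProperFilter U by exact: ultra_proper.
have gN j : `|g j| <= N j.
  apply: (weakly_to_le_norm ipC ip_linear ip_norm (gP j) _ (NP j)).
  by apply: filterS (@filterT _ U _).
exists g, xi; split.
- move=> j; apply: (cvgr_to_ge (xiP j)); apply: filterS cert => t [xi0 _ _].
  exact: xi0.
- have lim : (beta t + \sum_j ip ((gx t).1 j) (oc j) - \sum_j (gx t).2 j * orho j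
      - \sum_j orad j * `|(gx t).1 j|) @[t --> U] -->
    beta' + \sum_j ip (g j) (oc j) - \sum_j xi j * orho j - \sum_j orad j * N j.
    apply: cvgB; last by apply: cvg_big_sum => j; exact: cvgMr.
    apply: cvgB; last by apply: cvg_big_sum => j; exact: cvgMl.
    by apply: cvgD => //; apply: cvg_big_sum => j; exact: gP.
  apply: (@le_trans _ _ (beta' + \sum_j ip (g j) (oc j) - \sum_j xi j * orho j -
      \sum_j orad j * N j)).
    by apply: (cvgr_to_ge lim); apply: filterS cert => t [].
  rewrite lerD2l lerN2; apply: ler_sum => j _; rewrite ler_wpM2l// ltW//.
  by apply: le_lt_trans (fc j).
apply: (ip_ext ip_linear ip_norm) => a; rewrite (ip0l ip_linear).
have lim : ip (- h t + \sum_j (gx t).1 j - \sum_j (gx t).2 j *: ov j) a @[t --> U] -->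
    ip (- h' + \sum_j g j - \sum_j xi j *: ov j) a.
  rewrite (ipBl ip_linear) (ipDl ip_linear) (ipNl ip_linear) !(ip_suml ip_linear).
  under eq_fun do
    rewrite (ipBl ip_linear) (ipDl ip_linear) (ipNl ip_linear) !(ip_suml ip_linear).
  apply: cvgB; last first.
    apply: cvg_big_sum => j; rewrite (ipZl ip_linear).
    by under eq_fun do rewrite (ipZl ip_linear); exact: cvgMl.
  apply: cvgD; first by apply: cvgN; exact: hh'.
  by apply: cvg_big_sum => j; exact: gP.
have lim0 : ip (- h t + \sum_j (gx t).1 j - \sum_j (gx t).2 j *: ov j) a @[t --> U] --> 0.
  apply/cvgrPdist_le => e e0; apply: filterS cert => t [_ _ ->].
  by rewrite (ip0l ip_linear) subr0 normr0 ltW.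
exact: (cvg_unique (@Rhausdorff R) lim lim0).
Qed.

End Cell_certificates.

(** * Existence of minimizers *)

Section Omega.
Context {R : realType} {d Q B s : nat} (X : set 'rV[R]_d).
Hypothesis hX : X `<=` closure X°.
Context (K : 'rV[R]_d -> 'rV[R]_d -> 'M[R]_Q).
Hypotheses (hK : matrix_kernel X K) (hKs : Css X s K).
Context (F : completeNormedModType R) (ip : {dot F for idfun}).
Context (ev : F -> 'rV[R]_d -> 'cV[R]_Q).
Hypothesis hF : is_rkhs X K ip ev.
Context (c : constraint d Q B F).
Hypothesis hD : forall p1 p2 : 'I_(cP c), in_O s (cD p1 p2).
Hypothesis hsym : forall (f : F) x, X x -> (diff_mx X ev c f x)^T = diff_mx X ev c f x.
Hypothesis hP1 : cP c = 1%N.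

Let ipC := dot_sym ip.
Let ip_linear := dot_linear ip.
Let ip_norm := rkhs_normE hF.

Lemma omega_setP (wc : cell_cover F) (z : F * 'cV[R]_B) :
  (forall m (j : 'I_(oJB (@ocell _ _ wc m))), 0 < orad j) ->
  omega_set ip c wc z <-> forall (p : 'I_(cP c)) (m : 'I_(oM wc)), exists g xi,
    certifies (w := ocell m) ip (z.1 - cf0 c) (- cb0 c p 0 + (cGamma c *m z.2) p 0) g xi.
Proof.
move=> r0; split=> h p m.
  by have [g [xi [gs xi0 h0 eq0]]] := h p m; exists g, xi.
have [g [xi cert]] := h p m.
have [g' g's [xi0 h0 eq0]] := certifies_in_span ip_norm (r0 m) cert.
by exists g', xi.
Qed.

(** With a single index the quadratic form is a square times the scalar constraint, which a
    certificate settles on the closed cell containing DK(., x). *)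
Lemma omega_set_original (wc : cell_cover F) (A : set 'rV[R]_d) z x :
  (forall p : 'I_(cP c), is_cell_cover ip [set DKelt X K ev (cD p p) x | x in A] wc) ->
  A x -> X x -> omega_set ip c wc z -> loewner 0 (cons_mx X ev c z x).
Proof.
move=> cov Ax Xx om; apply/(loewner0_cons_mx hX hK hKs hF hD hsym _ Xx) => u.
have hP : (0 < cP c)%N by rewrite hP1.
pose p := Ordinal hP.
have one (q : 'I_(cP c)) : q = p.
  by apply/val_inj => /=; have := ltn_ord q; rewrite {2}hP1 ltnS leqn0 => /eqP.
have sum1 (V : nmodType) (f : 'I_(cP c) -> V) : \sum_q f q = f p.
  by rewrite (bigD1 p)//= big1 ?addr0// => q; rewrite (one q) eqxx.
rewrite /quad_elt /quad_affine !sum1 (ipZr ipC ip_linear) -expr2 -mulrDr.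
rewrite mulr_ge0 ?sqr_ge0//.
have [_ r0 _ cA] := cov p.
have [m _ xm] := cA _ (ex_intro2 _ _ x Ax erefl).
have [g [xi cert]] := (omega_setP _ r0).1 om p m.
by have := certifies_cell ip_norm cert xm; rewrite addrC (addrC (- _)).
Qed.

Lemma omega_weakly_closed (wc : cell_cover F) A T (U : set_system T) (UU : UltraFilter U)
    (z : T -> F * 'cV[R]_B) (l : F * 'cV[R]_B) :
  (forall p : 'I_(cP c), is_cell_cover ip [set DKelt X K ev (cD p p) x | x in A] wc) ->
  weakly_to ip U (fst \o z) l.1 -> (forall p, (z t).2 p 0 @[t --> U] --> l.2 p 0) ->
  (\forall t \near U, omega_set ip c wc (z t)) -> omega_set ip c wc l.
Proof.
move=> cov z1 z2 hz.
have UP : ProperFilter U by exact: ultra_proper.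
have hP : (0 < cP c)%N by rewrite hP1.
have [ne r0 _ _] := cov (Ordinal hP).
apply/(omega_setP _ r0) => p m.
apply: (certifies_weakly_closed ip_norm UU (ne m)
  (h := fun t => (z t).1 - cf0 c)
  (beta := fun t => - cb0 c p 0 + (cGamma c *m (z t).2) p 0)).
- move=> g; rewrite (ipBl ip_linear); under eq_fun do rewrite (ipBl ip_linear).
  by apply: cvgB; [exact: z1|exact: cvg_cst].
- apply: cvgD; first exact: cvg_cst.
  rewrite mxE; under eq_fun do rewrite mxE.
  by apply: cvg_big_sum => q; apply: cvgMr; exact: z2.
- by apply: filterS hz => t /(omega_setP _ r0).
Qed.

End Omega.

(** * Convergence in the weak topology *)

Lemma cvg_initial (S : choiceType) (T : topologicalType) (f : S -> T)
    (G : set_system S) (x : S) : Filter G ->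
  f y @[y --> G] --> f x -> G --> (x : initial_topology f).
Proof.
move=> FG fx A /= [_ [[B oB <-] Bfx BA]].
by apply: filterS BA _; apply: fx; exact: open_nbhs_nbhs.
Qed.

Section Weak_topology.
Context {R : realType} {F : completeNormedModType R} (ip : {dot F for idfun}) {n : nat}.
Hypothesis ip_norm : forall f, ip f f = `|f| ^+ 2.

Let ipC := dot_sym ip.
Let ip_linear := dot_linear ip.

Lemma continuous_form_representer
    (phi : {linear (F * 'cV[R]_n)%type -> R^o}) : continuous phi ->
  exists a, forall f, phi (f, 0) = ip f a.
Proof.
move=> cphi.
have /linear_boundedP bphi : bounded_near phi (nbhs (0 : (F * 'cV[R]_n)%type)).
  by apply: continuous_linear_bounded; exact: cphi.
have [C [_ hC]] := bphi.
have {}hC : forall z, `|phi z| <= (C + 1) * `|z| by apply: hC; rewrite ltrDl.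
have nf (f : F) : `|(f, 0 : 'cV[R]_n)| = `|f|.
  by rewrite prod_normE /= normr0; apply/max_idPl.
have [|||a _ fa] := riesz ipC ip_linear ip_norm (S := setT)
    (l := fun f => phi (f, 0 : 'cV[R]_n)) (C := C + 1) => //.
- move=> a f g _ _.
  have -> : (a *: f + g, 0 : 'cV[R]_n) = a *: (f, 0 : 'cV[R]_n) + (g, 0).
    by congr pair; rewrite /= scaler0 addr0.
  by rewrite linearD linearZ.
- by move=> f _; rewrite -nf.
by exists a => f; rewrite ipC fa.
Qed.

(** A continuous linear form on the product is an inner product with some [a] plus a finite
    combination of coordinates, so convergence tested on these two kinds is weak convergence. *)
Lemma cvg_weak_topology (U : set_system (F * 'cV[R]_n)) {FU : Filter U}
    (l : F * 'cV[R]_n) :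
  weakly_to ip U fst l.1 -> (forall p, (fun z : F * 'cV[R]_n => z.2 p 0) @ U --> l.2 p 0) ->
  U --> (l : weak_topology (F * 'cV[R]_n)%type).
Proof.
move=> z1 z2.
have key (phi : {linear (F * 'cV[R]_n)%type -> R^o}) : continuous phi ->
    phi z @[z --> U] --> phi l.
  move=> cphi.
  have [a phia] := continuous_form_representer cphi.
  have phiD (b b' : 'cV[R]_n) : phi (0, b + b') = phi (0, b) + phi (0, b').
    by rewrite -linearD; congr (phi _); congr pair; rewrite /= addr0.
  have phiZ r (b : 'cV[R]_n) : phi (0, r *: b) = r * phi (0, b).
    by rewrite -[RHS]/(r *: phi (0, b)) -linearZ; congr (phi _); congr pair; rewrite /= scaler0.
  have phi0 : phi (0, 0) = 0 by rewrite -[RHS](linear0 phi).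
  have phiE z : phi z = ip z.1 a + \sum_p z.2 p 0 * phi (0, delta_mx p 0).
    case: z => f b; rewrite -phia.
    rewrite [in LHS](_ : (f, b) = (f, 0) + (0, b)); last by congr pair; rewrite /= ?addr0 ?add0r.
    rewrite linearD; congr (_ + _).
    rewrite [in LHS](_ : b = \sum_p b p 0 *: delta_mx p 0); last first.
      by rewrite {1}[b]matrix_sum_delta; apply: eq_bigr => p _; rewrite big_ord1.
    rewrite (big_morph (fun b => phi (0, b)) phiD phi0).
    by apply: eq_bigr => p _; rewrite phiZ.
  have h1 : (ip z.1 a + \sum_p (z : F * 'cV[R]_n).2 p 0 * phi (0, delta_mx p 0)) @[z --> U]
      --> ip l.1 a + \sum_p l.2 p 0 * phi (0, delta_mx p 0).
    apply: cvgD; first exact: (z1 a).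
    by apply: cvg_big_sum => p; apply: cvgMl; exact: z2.
  rewrite (phiE l); apply: cvg_trans h1; apply: near_eq_cvg.
  by apply: filterS (@filterT _ U _) => z _; rewrite -phiE.
apply: cvg_initial; apply/cvg_sup => -[phi cphi].
apply: cvg_initial => /=; exact: key.
Qed.

End Weak_topology.

(* A weak ultralimit of a filter refining {L <= gamma} on D, gamma > inf L,
   attains the infimum. *)
Lemma minimizer_exists (R : realType) (F : completeNormedModType R)
    (ip : {dot F for idfun}) (n : nat) (L : F * 'cV[R]_n -> \bar R)
    (D : set (F * 'cV[R]_n)) :
  (forall f, ip f f = `|f| ^+ 2) -> (forall z, L z != -oo%E) ->
  weakly_lsc L -> coercive L -> (exists2 z, D z & edom L z) ->
  (forall (U : set_system (F * 'cV[R]_n)) (l : F * 'cV[R]_n), UltraFilter U ->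
    weakly_to ip U fst l.1 -> (forall p, (fun z : F * 'cV[R]_n => z.2 p 0) @ U --> l.2 p 0) ->
    U D -> D l) ->
  exists l, minimizer (Problem L D) l.
Proof.
move=> ip_norm Lny wlsc coer [z0 Dz0 Lz0] Dcl.
(* The levels reached on [D]. Their sublevel sets are nested and nonempty, hence a filter base. The
   infimum is never named: the limit lies below every level in [I], and each finite value of [L] on
   [D] is such a level. *)
pose I := [set gamma : R | exists2 z, D z & (L z <= gamma%:E)%E].
pose G := filter_from I (fun gamma => D `&` [set z | (L z <= gamma%:E)%E]).
have [g0 Ig0] : exists g0, I g0.
  case Lz0E : (L z0) => [r| |].
  - by exists r, z0 => //; rewrite Lz0E.
  - by rewrite /edom /= Lz0E in Lz0.
  - by have := Lny z0; rewrite Lz0E.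
have GF : ProperFilter G.
  apply: filter_from_proper; last by move=> g [z Dz Lz]; exists z.
  apply: filter_from_filter; first by exists g0.
  move=> a b Ia Ib; have [ab|ba] := leP a b.
    exists a => // z [Dz La]; split=> //; split=> //.
    by apply: le_trans La _; rewrite lee_fin.
  exists b => // z [Dz Lb]; split=> //; split=> //.
  by apply: le_trans Lb _; rewrite lee_fin ltW.
have [U [UU GU]] := ultraFilterLemma GF.
have UP : ProperFilter U by exact: ultra_proper.
have UI g : I g -> U (D `&` [set z | (L z <= g%:E)%E]) by move=> Ig; apply: GU; exists g.
have UD : U D by apply: filterS (UI _ Ig0) => z [].
have [M zM] : exists M, \forall z \near U, `|z| <= M.
  have [M [_ hM]] := coer g0; exists (M + 1).
  apply: filterS (UI _ Ig0) => z [_ Lz].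
  by apply: (hM (M + 1)) Lz; rewrite ltrDl.
have [|f hf] := ultra_weakly_to (dot_sym ip) (dot_linear ip) ip_norm UU (h := fst) (M := M).
  by apply: filterS zM => z; rewrite prod_normE ge_max => /andP[].
have /choice[b hb] : forall p, exists b : R, (fun z : F * 'cV[R]_n => z.2 p 0) @ U --> b.
  move=> p; apply: (ultra_cvg_bounded UU (M := M)).
  apply: filterS zM => z; rewrite prod_normE ge_max => /andP[_]; apply: le_trans.
  by rewrite [leRHS]mx_normrE; exact: (le_bigmax _ (fun ij => `|z.2 ij.1 ij.2|) (p, 0)).
pose l : F * 'cV[R]_n := (f, \col_p b p).
have l2 p : (fun z : F * 'cV[R]_n => z.2 p 0) @ U --> l.2 p 0 by rewrite mxE; exact: hb.
have Dl : D l by exact: (Dcl U).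
have Ul : U --> (l : weak_topology (F * 'cV[R]_n)%type).
  exact: (cvg_weak_topology ip_norm).
have Ll g : I g -> (L l <= g%:E)%E.
  move=> Ig; apply: (closed_cvg _ (wlsc g) _ _ Ul).
  by apply: filterS (UI _ Ig) => z [].
exists l; split=> // z Dz /=.
case LzE : (L z) => [r| |]; last 2 first.
- exact: leey.
- by have := Lny z; rewrite LzE.
by apply: Ll; exists z => //; rewrite LzE.
Qed.

Theorem theorem5 (R : realType) (d Q B s nI : nat)
  (normX : 'rV[R]_d -> R) (hnormX : is_norm normX)
  (X : set 'rV[R]_d) (hX : X `<=` closure X°)
  (K : 'rV[R]_d -> 'rV[R]_d -> 'M[R]_Q)
  (hK : matrix_kernel X K) (hKs : Css X s K)
  (F : completeNormedModType R) (ip : {dot F for idfun})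
  (ev : F -> 'rV[R]_d -> 'cV[R]_Q) (hF : is_rkhs X K ip ev)
  (ISOC IOmega : {set 'I_nI})
  (hI_cover : (ISOC :|: IOmega)%SET = [set: 'I_nI]%SET)
  (hI_disj : forall i, i \in ISOC -> i \notin IOmega)
  (c : 'I_nI -> constraint d Q B F)
  (hc_compact : forall i, compact (cset (c i)))
  (hc_X : forall i, cset (c i) `<=` X)
  (hP : forall i, (0 < cP (c i))%N)
  (hP_Omega : forall i, i \in IOmega -> cP (c i) = 1%N)
  (hD : forall i (p1 p2 : 'I_(cP (c i))), in_O s (cD p1 p2))
  (hD_sym : forall i (f : F) x, X x ->
     (diff_mx X ev (c i) f x)^T = diff_mx X ev (c i) f x)
  (bc : 'I_nI -> ball_cover R d)
  (hbc : forall i, i \in ISOC -> is_ball_cover X normX (cset (c i)) (bc i))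
  (wc : 'I_nI -> cell_cover F)
  (hwc : forall i, i \in IOmega -> forall p : 'I_(cP (c i)),
     is_cell_cover ip
       [set DKelt X K ev (cD p p) x | x in cset (c i)] (wc i))
  (L : F * 'cV[R]_B -> \bar R) (hL : forall z, L z != -oo%E)
  (Fhat : set F) (hFhat_sub : submod_closed [in Fhat])
  (hFhat_closed : closed Fhat) :
  let C := original_set X ev c in
  let Capp := tightened_set X normX K ip ev c ISOC IOmega bc wc in
  let P := Problem L C in
  let Papp := Problem L ([set z | Fhat z.1] `&` Capp) in
  (weakly_lsc L -> coercive L ->
   (exists z : F * 'cV[R]_B, [/\ Capp z, edom L z & Fhat z.1]) ->
   (exists zapp, minimizer Papp zapp) /\ (exists z, minimizer P z)) /\
  (forall Prelax : problem (F * 'cV[R]_B)%type, relaxation Prelax P ->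
   (optimal_value Prelax <= optimal_value P)%E /\
   (optimal_value P <= optimal_value Papp)%E).
Proof.
move=> C Capp P Papp.
pose ipN := rkhs_normE hF.
(* This inclusion serves both claims: it makes [P] feasible and it bounds its optimal value by that
   of [Papp]. *)
have CappC z : Capp z -> C z.
  move=> [zs zo] i x Ax; have Xx := hc_X i _ Ax.
  have : i \in (ISOC :|: IOmega)%SET by rewrite hI_cover inE.
  rewrite inE => /orP[iS|iO].
    apply: (soc_set_original hX hK hKs hF (hD i) (hD_sym i) (hbc i iS) Ax Xx).
    exact: zs.
  apply: (omega_set_original hX hK hKs hF (hD i) (hD_sym i) (hP_Omega i iO) (hwc i iO) Ax Xx).
  exact: zo.
have Cw (U : set_system (F * 'cV[R]_B)) (l : F * 'cV[R]_B) : UltraFilter U ->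
    weakly_to ip U fst l.1 -> (forall p, (fun z : F * 'cV[R]_B => z.2 p 0) @ U --> l.2 p 0) ->
    U C -> C l.
  move=> UU z1 z2 UC i x Ax; have UP : ProperFilter U by exact: ultra_proper.
  apply: (original_weakly_closed hX hK hKs hF (hD i) (hD_sym i) (hc_X i _ Ax) (z := id) z1 z2).
  by apply: filterS UC => z; exact.
have Fhat_sub : lin_subspace Fhat.
  case: hFhat_sub => h0 h1; split=> [|a f g Ff Fg]; first by rewrite inE in h0.
  by have := h1 a f g; rewrite !inE; apply.
have Cappw (U : set_system (F * 'cV[R]_B)) (l : F * 'cV[R]_B) : UltraFilter U ->
    weakly_to ip U fst l.1 -> (forall p, (fun z : F * 'cV[R]_B => z.2 p 0) @ U --> l.2 p 0) ->
    U ([set z | Fhat z.1] `&` Capp) -> ([set z | Fhat z.1] `&` Capp) l.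
  move=> UU z1 z2 UC; have UP : ProperFilter U by exact: ultra_proper.
  split.
    apply: (weakly_to_closed (dot_sym ip) (dot_linear ip) ipN Fhat_sub hFhat_closed _ z1).
    by apply: filterS UC => z [].
  split=> i iI.
    apply: (soc_weakly_closed hX hK hKs hF (hD i) (hD_sym i) hnormX (hP i) (hbc i iI)
      (z := id) z1 z2).
    by apply: filterS UC => z [_ [+ _]]; exact.
  apply: (omega_weakly_closed hF (hP_Omega i iI) UU (z := id) (hwc i iI) z1 z2).
  by apply: filterS UC => z [_ [_]]; exact.
split.
  move=> wlsc coer [z [Cz Lz Fz]]; split.
    by apply: (minimizer_exists ipN hL wlsc coer) => //; exists z.
  by apply: (minimizer_exists ipN hL wlsc coer) => //; exists z => //; exact: CappC.
move=> Pr [obj sub]; split; rewrite /optimal_value.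
  by rewrite obj; apply: ereal_inf_le_tmp; exact: image_subset.
by apply: ereal_inf_le_tmp; apply: image_subset => z [_]; exact: CappC.
Qed.
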